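(* Let $\varphi$ be a local flat folding of the plane whose graph $G$ is finite. Then $G$ is 2-vertex-connected and 4-edge-connected.
   Context: Local flat folding: a continuous function $\varphi:\mathbb{R}^2\to\mathbb{R}^2$ such that every point $p$ of the plane is of one of the following three types, and at least one point is a vertex point. (1) Unfolded point: $p$ has a neighborhood mapped by $\varphi$ in a distance-preserving way. (2) Crease point: $p$ has a neighborhood $N$ that can be covered by two subsets, each containing $p$ and each mapped by $\varphi$ in a different distance-preserving way. (Necessarily the boundary between the subsets is a line through $p$, and the two isometries are reflections of each other across the image of this line; points of $N$ on this line are also crease points and the other points of $N$ are unfolded points.) (3) Vertex point: $p$ has a neighborhood $N$ that can be covered by finitely many (at least three) subsets, each containing $p$ and each mapped by $\varphi$ in a distance-preserving way, with at least three distinct isometries among these subsets. (Necessarily each subset is a wedge with apex $p$; points of $N$ other than $p$ on the rays between pairs of wedges are crease points and the remaining points of $N$ other than $p$ are unfolded points.) Graph of a local flat folding $\varphi$: the multigraph $G$ with a vertex for each vertex point of $\varphi$ and, if $\varphi$ includes any infinite rays of crease points, one additional special vertex $\infty$. Two vertex points are joined by an edge when the line segment between them consists (apart from its endpoints) only of crease points. For each ray with apex at a vertex point $p$ all of whose points other than the apex are crease points, there is an edge between $p$ and $\infty$ (so there may be several parallel edges between $p$ and $\infty$, but at most one edge between any two vertex points). 2-vertex-connected means that $G$ is connected and has no articulation vertex (a vertex whose removal disconnects the graph; a graph with one vertex is not disconnected). 4-edge-connected means that the removal of any at most three edges does not disconnect $G$. *)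

(* Defs.v *)
From Stdlib Require Import Relation_Operators.
From mathcomp Require Import all_boot all_order all_algebra.
From mathcomp Require Import all_classical all_reals all_analysis.

Set Implicit Arguments.
Unset Strict Implicit.
Unset Printing Implicit Defensive.

Import Order.TTheory GRing.Theory Num.Theory numFieldNormedType.Exports.

Local Open Scope classical_set_scope.
Local Open Scope card_scope.
Local Open Scope ring_scope.

(* The norm that the library puts on R * R is the max norm: it has the usual
   topology of the plane but not its isometries. *)
Definition edist (R : realType) (x y : R * R) : R :=
  Num.sqrt ((x.1 - y.1) ^+ 2 + (x.2 - y.2) ^+ 2).

Definition preserves_dist_on (R : realType) (A : set (R * R))
    (f : R * R -> R * R) : Prop :=
  forall x y, A x -> A y -> edist (f x) (f y) = edist x y.

(* phi maps A in the distance-preserving way f.  The isometry f is taken on the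
   whole plane so that the ways in which two different subsets are mapped can
   be compared. *)
Definition maps_by (R : realType) (phi : R * R -> R * R) (A : set (R * R))
    (f : R * R -> R * R) : Prop :=
  preserves_dist_on setT f /\ (forall x, A x -> phi x = f x).

(* The three types of points are mutually exclusive, hence the negative clauses
   in crease_point and vertex_point.  Without them a degenerate cover such as
   N = N `|` [set p] would make every unfolded point a crease point and a
   vertex point as well, since many isometries map p to phi p. *)
Definition unfolded_point (R : realType) (phi : R * R -> R * R)
    (p : R * R) : Prop :=
  exists N, nbhs p N /\ preserves_dist_on N phi.

Definition crease_point (R : realType) (phi : R * R -> R * R)
    (p : R * R) : Prop :=
  ~ unfolded_point phi p /\
  exists (N A B : set (R * R)) (f g : R * R -> R * R),
    [/\ nbhs p N, N = A `|` B, A p /\ B p,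
        maps_by phi A f /\ maps_by phi B g & f <> g].

Definition vertex_point (R : realType) (phi : R * R -> R * R)
    (p : R * R) : Prop :=
  [/\ ~ unfolded_point phi p, ~ crease_point phi p &
  exists (N : set (R * R)) (n : nat) (A : 'I_n -> set (R * R))
      (f : 'I_n -> R * R -> R * R),
    [/\ nbhs p N, (3 <= n)%N /\ N = \bigcup_i A i, forall i, A i p,
        forall i, maps_by phi (A i) (f i) &
        exists i j k, [/\ f i <> f j, f i <> f k & f j <> f k]]].

Definition local_flat_folding (R : realType) (phi : R * R -> R * R) : Prop :=
  [/\ continuous phi,
      forall p, [\/ unfolded_point phi p, crease_point phi p
                 | vertex_point phi p] &
      exists p, vertex_point phi p].

(* [joins e u v] is meant to be symmetric in u and v. *)
Record multigraph := Multigraph {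
  vtx : Type;
  edg : Type;
  vertices : set vtx;
  edges : set edg;
  joins : edg -> vtx -> vtx -> Prop
}.

Arguments vertices : clear implicits.
Arguments edges : clear implicits.
Arguments joins : clear implicits.

Definition finite_graph (G : multigraph) : Prop :=
  finite_set (vertices G) /\ finite_set (edges G).

Definition adjacent (G : multigraph) (u v : vtx G) : Prop :=
  exists2 e, edges G e & joins G e u v.

Definition connected_graph (G : multigraph) : Prop :=
  forall u v, vertices G u -> vertices G v ->
    clos_refl_trans (vtx G) (@adjacent G) u v.

Definition remove_vertex (G : multigraph) (x : vtx G) : multigraph :=
  {| vertices := [set v | vertices G v /\ v <> x];
     edges := [set e | edges G e /\ forall v, ~ joins G e x v];
     joins := joins G |}.

Definition remove_edges (G : multigraph) (F : set (edg G)) : multigraph :=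
  {| vertices := vertices G;
     edges := edges G `\` F;
     joins := joins G |}.

Definition articulation_vertex (G : multigraph) (x : vtx G) : Prop :=
  vertices G x /\ ~ connected_graph (remove_vertex x).

Definition two_vertex_connected (G : multigraph) : Prop :=
  connected_graph G /\ forall x : vtx G, ~ articulation_vertex x.

Definition four_edge_connected (G : multigraph) : Prop :=
  forall F : set (edg G), F `<=` edges G -> F #<= `I_3 ->
    connected_graph (remove_edges F).

Definition open_segment (R : realType) (p q : R * R) : set (R * R) :=
  [set p + t *: (q - p) | t in [set t : R | 0 < t < 1]].

Definition open_ray (R : realType) (p d : R * R) : set (R * R) :=
  [set p + t *: d | t in [set t : R | 0 < t]].

(* [Some p] is the vertex point p and [None] is the special vertex oo.  An edge
   is the open segment or open ray of crease points that it stands for, as a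
   subset of the plane; its end points can be recovered from it. *)
Definition folding_joins (R : realType) (phi : R * R -> R * R)
    (e : set (R * R)) (u v : option (R * R)) : Prop :=
  let ray_from p := vertex_point phi p /\
    exists d, [/\ d <> 0, e = open_ray p d & e `<=` crease_point phi] in
  match u, v with
  | Some p, Some q =>
      [/\ vertex_point phi p, vertex_point phi q, p <> q,
          e = open_segment p q & e `<=` crease_point phi]
  | Some p, None => ray_from p
  | None, Some p => ray_from p
  | None, None => False
  end.

Definition folding_vertices (R : realType) (phi : R * R -> R * R) :
    set (option (R * R)) :=
  fun u => match u with
  | Some p => vertex_point phi p
  | None => exists p d, d <> 0 /\ open_ray p d `<=` crease_point phi
  end.

Definition folding_graph (R : realType) (phi : R * R -> R * R) : multigraph :=
  {| vertices := folding_vertices phi;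
     edges := [set e | exists u v, folding_joins phi e u v];
     joins := folding_joins phi |}.

(* Main.v *)
(* Every point q has a neighbourhood on which phi preserves the distance to q, so phi is
   1-Lipschitz, and near a vertex point p it commutes with homotheties of center p.

   - At a vertex point p every open half plane bounded by a line through p contains a crease
     direction: otherwise phi is an isometry f on a half disc, and being 1-Lipschitz it
     can only be f or f after a reflection on the other half, so that p would be
     unfolded or a crease point.
   - phi changes orientation exactly when a crease is crossed, hence the number of edges at
     a vertex point is even.

   Let X be a set of vertex points that is a component, not containing oo, left by the removal of
   at most three edges.  Degrees being even, an even number of edges leave X, so at most two, and
   some direction u has nonpositive inner product with both.  This contradicts the existence of an
   edge with positive inner product with u at a point of X that is extremal in the direction u.
   Applied with u = p - p0, the same extremal argument leads from p to oo avoiding p0.  Finally,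
   if removing oo separated the vertex points, a minimal distance argument between the edges of two
   classes would give a contradiction, an edge at every vertex point being able to approach any
   given point. *)
Require Import Defs.
From mathcomp Require Import all_boot all_order all_algebra.
From mathcomp Require Import all_classical all_reals all_analysis.
From mathcomp Require Import ring lra finmap.
(* all_analysis shadows edist. *)
Import Defs.

Set Implicit Arguments.
Unset Strict Implicit.
Unset Printing Implicit Defensive.

Import Order.TTheory GRing.Theory Num.Theory numFieldNormedType.Exports.

Local Open Scope classical_set_scope.
Local Open Scope card_scope.
Local Open Scope ring_scope.

(** * Real induction and plane vectors *)

Section Plane.
Variable R : realType.
Implicit Types (x y z u v w p q : R * R) (s t k r : R).

(** The covering pieces in the definitions are arbitrary sets, so neither the line through a crease
    point nor the wedges at a vertex point are given. The cover at a vertex point enters only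
    through the distances to that point: each piece contains it, so its isometry keeps them.
    Homogeneity then stands in for the wedges, since it makes the type of a point constant along
    each short ray from the vertex point. At a crease point the line is derived from the two
    isometries.

    Isometries are continued along segments by real induction, which takes the place of compactness
    and connectedness; this is why convex regions are used wherever possible.

    Parity is what brings three removed edges down to two: three directions may positively span the
    plane, and then no direction is obtuse to all of them.

    For edge cuts and for the removal of a vertex point, oo is a hub, so it suffices to reach it.
    When oo itself is removed no vertex can play that part, whence the metric argument. *)

Lemma real_induction (P : R -> Prop) a b :
  P a ->
  (forall t, a <= t < b -> (forall s, a <= s <= t -> P s) ->
     exists2 e : R, 0 < e & forall s, t < s < t + e -> P s) ->
  (forall t, a < t <= b -> (forall s, a <= s < t -> P s) -> P t) ->
  forall t, a <= t <= b -> P t.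
Proof.
move=> Pa right lim t0 /andP[at0 t0b].
pose S := [set s | a <= s <= t0 /\ forall r, a <= r <= s -> P r].
have Sa : S a.
  split; first by rewrite lexx.
  by move=> r; rewrite -eq_le => /eqP <-.
have hS : has_sup S by split; [exists a | exists t0 => s [/andP[]]].
set m := sup S.
have am : a <= m by apply: ub_le_sup => //; case: hS.
have mt0 : m <= t0 by apply: ge_sup; [exists a | move=> s [/andP[]]].
have below s : a <= s < m -> P s.
  move=> /andP[as_ sm].
  have [r [/andP[_ _] Sr] sr] := sup_adherent (ltac:(by rewrite subr_gt0;
    exact: sm) : 0 < m - s) hS.
  apply: Sr; rewrite as_ /=; move: sr; rewrite -/m; lra.
have upto s : a <= s <= m -> P s.
  move=> /andP[as_ sm].
  have [sltm|] := ltP s m; first by apply: below; rewrite as_.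
  move=> ms; have -> : s = m by lra.
  have [aeq|altm] : a = m \/ a < m by lra.
    by rewrite -aeq.
  by apply: lim; [rewrite altm /=; lra | exact: below].
have [mlt|] := ltP m t0; last by move=> t0m; apply: upto; lra.
have [|e e0 he] := right m _ upto; first by rewrite am (lt_le_trans mlt t0b).
pose s := Num.min (m + e / 2) t0.
have : S s.
  have ms : m < s by rewrite /s lt_min mlt andbT; lra.
  split; first by rewrite (le_trans am (ltW ms)) /s ge_min lexx orbT.
  move=> r /andP[ar rs]; have [rm|mr] := leP r m; first by apply: upto; rewrite ar.
  apply: he; rewrite mr /=; apply: (le_lt_trans rs); rewrite /s gt_min; apply/orP; left; lra.
move=> /(ub_le_sup (proj2 hS)); rewrite -/m /s => /le_lt_trans h.
have : m < Num.min (m + e / 2) t0 by rewrite lt_min mlt andbT; lra.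
by move=> /h; rewrite ltxx.
Qed.

Definition dot u v : R := u.1 * v.1 + u.2 * v.2.
Definition cross u v : R := u.1 * v.2 - u.2 * v.1.
Definition enorm v : R := Num.sqrt (v.1 ^+ 2 + v.2 ^+ 2).
Definition perp v : R * R := (- v.2, v.1).

Lemma edistE x y : edist x y = enorm (x - y). Proof. by []. Qed.

Lemma pair_eq x y : x.1 = y.1 -> x.2 = y.2 -> x = y.
Proof. by case: x y => [? ?] [? ?] /= -> ->. Qed.

(** A bundle of rewrite rules that push projections through the vector operations, so that [ring]
    and [lra] are left with real coordinates. *)
Lemma coordE :
  ((forall x y, ((x + y).1 = x.1 + y.1)%R) * (forall x y, ((x + y).2 = x.2 + y.2)%R) *
   (forall x, ((- x).1 = - x.1)%R) * (forall x, ((- x).2 = - x.2)%R) *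
   (forall t x, ((t *: x).1 = t * x.1)%R) * (forall t x, ((t *: x).2 = t * x.2)%R) *
   ((0 : R * R).1 = 0)%R * ((0 : R * R).2 = 0)%R)%type.
Proof. by []. Qed.

Lemma enorm_sq v : enorm v ^+ 2 = dot v v.
Proof. by rewrite /enorm sqr_sqrtr ?addr_ge0 ?sqr_ge0. Qed.

Lemma enorm_ge0 v : 0 <= enorm v. Proof. exact: sqrtr_ge0. Qed.

Lemma le_sqr_sqrt (a b : R) : 0 <= a -> 0 <= b -> (a <= b) = (a ^+ 2 <= b ^+ 2).
Proof. by move=> a0 b0; rewrite ler_sqr ?nnegrE. Qed.

Lemma enormD u v : enorm (u + v) <= enorm u + enorm v.
Proof.
rewrite le_sqr_sqrt ?addr_ge0 ?enorm_ge0 //.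
have := enorm_sq u; have := enorm_sq v; have := enorm_sq (u + v).
have := enorm_ge0 u; have := enorm_ge0 v.
move: (enorm u) (enorm v) (enorm (u + v)) => a b c b0 a0.
rewrite /dot !coordE => -> hb ha.
have ab0 : 0 <= a * b by apply: mulr_ge0.
have : dot u v <= a * b.
  rewrite /dot; apply: le_trans (ler_norm _) _.
  rewrite le_sqr_sqrt // ?normr_ge0 // real_normK ?num_real // exprMn ha hb.
  have := sqr_ge0 (u.1 * v.2 - u.2 * v.1); nra.
rewrite /dot; nra.
Qed.

Lemma enormZ t v : enorm (t *: v) = `|t| * enorm v.
Proof.
rewrite /enorm !coordE !exprMn -mulrDr sqrtrM ?sqr_ge0 //.
by rewrite sqrtr_sqr.
Qed.

Lemma enormN v : enorm (- v) = enorm v.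
Proof. by rewrite -scaleN1r enormZ normrN1 mul1r. Qed.

Lemma enorm0 : enorm 0 = 0.
Proof. by rewrite /enorm !coordE expr0n /= addr0 sqrtr0. Qed.

Lemma dot_eq0 v : dot v v = 0 -> v = 0.
Proof.
rewrite /dot => h; have h1 := sqr_ge0 v.1; have h2 := sqr_ge0 v.2.
rewrite !expr2 in h1 h2.
by apply: pair_eq => /=; apply/eqP; rewrite -[_ == 0]orbb -mulf_eq0; apply/eqP; lra.
Qed.

Lemma dot_ge0 v : 0 <= dot v v.
Proof. by rewrite -enorm_sq sqr_ge0. Qed.

Lemma dot_gt0 v : v <> 0 -> 0 < dot v v.
Proof. by move=> v0; rewrite lt_neqAle dot_ge0 andbT eq_sym; apply/eqP => /dot_eq0. Qed.

Lemma enorm_eq0 v : enorm v = 0 -> v = 0.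
Proof. by move=> h; apply: dot_eq0; rewrite -enorm_sq h expr0n. Qed.

Lemma enorm_gt0 v : v <> 0 -> 0 < enorm v.
Proof. by move=> v0; rewrite lt_neqAle enorm_ge0 andbT eq_sym; apply/eqP => /enorm_eq0. Qed.

Lemma enorm_le u v : (enorm u <= enorm v) = (dot u u <= dot v v).
Proof. by rewrite le_sqr_sqrt ?enorm_ge0 // !enorm_sq. Qed.

Lemma enorm_eq u v : enorm u = enorm v <-> dot u u = dot v v.
Proof.
split=> [h|h]; first by rewrite -!enorm_sq h.
by apply/eqP; rewrite eq_le !enorm_le h lexx.
Qed.

End Plane.

(** * Plane isometries and germs *)

Section Rigid.
Variable R : realType.
Implicit Types (x y z u v w p q a b : R * R) (s t k r o : R).

(** The topology comes from the max norm. [cle] bounds each coordinate by the Euclidean norm, and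
    [ecl] bounds the latter by a sum of two terms, whence the radius [e / 2]. *)
Lemma nbhs_enorm p (N : set (R * R)) :
  nbhs p N <-> exists2 e : R, 0 < e & forall x, enorm (x - p) < e -> N x.
Proof.
have cle v : `|v.1| <= enorm v /\ `|v.2| <= enorm v.
  split; rewrite le_sqr_sqrt ?normr_ge0 ?enorm_ge0 // enorm_sq real_normK ?num_real //;
  rewrite /dot; have := sqr_ge0 v.1; have := sqr_ge0 v.2; rewrite !expr2; lra.
have ecl v : enorm v <= `|v.1| + `|v.2|.
  rewrite le_sqr_sqrt ?addr_ge0 ?normr_ge0 ?enorm_ge0 // enorm_sq sqrrD !real_normK ?num_real //.
  by rewrite /dot !expr2; have := mulr_ge0 (normr_ge0 v.1) (normr_ge0 v.2); lra.
split.
- move=> /nbhs_ballP[e /= e0 he]; exists e => // x xe; apply: he.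
  have [h1 h2] := cle (x - p).
  by split; rewrite /ball /= distrC; apply: le_lt_trans xe.
- move=> [e e0 he]; apply/nbhs_ballP; exists (e / 2) => /=; first by lra.
  move=> x [] /=; rewrite /ball /= => h1 h2; apply: he.
  apply: le_lt_trans (ecl _) _; rewrite !coordE distrC [X in _ + X]distrC; lra.
Qed.

(* a is the image of (1, 0), and o = 1 or -1 is the determinant. *)
Definition lin o a x : R * R := (a.1 * x.1 - o * a.2 * x.2, a.2 * x.1 + o * a.1 * x.2).
Definition rigid o a b x : R * R := b + lin o a x.
Definition orth o a := (o = 1 \/ o = -1) /\ dot a a = 1.

Lemma dot_lin o a x y : orth o a -> dot (lin o a x) (lin o a y) = dot x y.
Proof.
rewrite /orth /dot /= => -[ho ha].
have o2 : o * o = 1 by case: ho => ->; lra.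
transitivity ((a.1 * a.1 + a.2 * a.2) * (x.1 * y.1 + o * o * (x.2 * y.2))); first by ring.
by rewrite ha o2; ring.
Qed.

Lemma rigidB o a b x y : rigid o a b x - rigid o a b y = lin o a (x - y).
Proof. by rewrite /rigid; apply: pair_eq; rewrite !coordE /=; ring. Qed.

Lemma enorm_lin o a x : orth o a -> enorm (lin o a x) = enorm x.
Proof. by move=> oa; apply/enorm_eq; rewrite dot_lin. Qed.

Lemma rigid_isometry o a b : orth o a -> preserves_dist_on setT (rigid o a b).
Proof. by move=> oa x y _ _; rewrite !edistE rigidB enorm_lin. Qed.

(** Polarization: three mutual distances determine an inner product. *)
Lemma dist_dot (f : R * R -> R * R) (N : set (R * R)) x y z :
  preserves_dist_on N f -> N x -> N y -> N z ->
  dot (f y - f x) (f z - f x) = dot (y - x) (z - x).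
Proof.
move=> h Nx Ny Nz.
have := h _ _ Ny Nx; have := h _ _ Nz Nx; have := h _ _ Ny Nz; rewrite !edistE =>
  /enorm_eq h1 /enorm_eq h2 /enorm_eq h3; move: h1 h2 h3.
by rewrite /dot !coordE; lra.
Qed.

Lemma isometry_rigid (f : R * R -> R * R) (N : set (R * R)) x :
  nbhs x N -> preserves_dist_on N f ->
  exists o a b, orth o a /\ forall y, N y -> f y = rigid o a b y.
Proof.
move=> /nbhs_enorm[e e0 he] hf.
have Nx : N x by apply: he; rewrite subrr enorm0.
pose r := e / 2; have r0 : 0 < r by rewrite /r; lra.
pose x1 := x + r *: ((1, 0) : R * R); pose x2 := x + r *: ((0, 1) : R * R).
have n1 : enorm ((1, 0) : R * R) = 1 by rewrite /enorm /= expr1n expr0n /= addr0 sqrtr1.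
have n2 : enorm ((0, 1) : R * R) = 1 by rewrite /enorm /= expr1n expr0n /= add0r sqrtr1.
have N1 : N x1 by apply: he; rewrite /x1 addrC addKr enormZ n1 gtr0_norm // /r; lra.
have N2 : N x2 by apply: he; rewrite /x2 addrC addKr enormZ n2 gtr0_norm // /r; lra.
(* Images of the basis vectors under the linear part to be found. They form an orthonormal frame, in
   which [f y - f x] has the coordinates of [y - x]. *)
pose A := r^-1 *: (f x1 - f x); pose B := r^-1 *: (f x2 - f x).
have rV : r^-1 * r = 1 by rewrite mulVf // gt_eqF.
have dA y : N y -> dot A (f y - f x) = y.1 - x.1.
  move=> Ny; transitivity (r^-1 * dot (f x1 - f x) (f y - f x)).
    by rewrite /A /dot !coordE; ring.
  rewrite (dist_dot hf) // /dot /x1 !coordE /=.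
  by transitivity (r^-1 * r * (y.1 - x.1)); [ring | rewrite rV mul1r].
have dB y : N y -> dot B (f y - f x) = y.2 - x.2.
  move=> Ny; transitivity (r^-1 * dot (f x2 - f x) (f y - f x)).
    by rewrite /B /dot !coordE; ring.
  rewrite (dist_dot hf) // /dot /x2 !coordE /=.
  by transitivity (r^-1 * r * (y.2 - x.2)); [ring | rewrite rV mul1r].
have AA : dot A A = 1.
  transitivity (r^-1 * dot A (f x1 - f x)); first by rewrite /A /dot !coordE; ring.
  by rewrite dA // /x1 !coordE /= -[RHS]rV; ring.
have AB : dot A B = 0.
  transitivity (r^-1 * dot A (f x2 - f x)); first by rewrite /A /B /dot !coordE; ring.
  by rewrite dA // /x2 !coordE /=; ring.
have BB : dot B B = 1.
  transitivity (r^-1 * dot B (f x2 - f x)); first by rewrite /B /dot !coordE; ring.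
  by rewrite dB // /x2 !coordE /= -[RHS]rV; ring.
move: AA AB BB dA dB; move: A B => [a1 a2] [b1 b2]; rewrite /dot /= => AA AB BB dA dB.
(* The determinant of the frame. Its square is the Gram determinant, and [B] is [o] times the
   quarter turn of [A]. *)
pose o := a1 * b2 - a2 * b1.
have oo : o * o = 1.
  transitivity ((a1 * a1 + a2 * a2) * (b1 * b1 + b2 * b2) - (a1 * b1 + a2 * b2) ^+ 2).
    by rewrite /o; ring.
  by rewrite AA BB AB; ring.
have hb1 : b1 = - (o * a2).
  transitivity ((a1 * a1 + a2 * a2) * b1 - a1 * (a1 * b1 + a2 * b2)); last by rewrite /o; ring.
  by rewrite AA AB; ring.
have hb2 : b2 = o * a1.
  transitivity ((a1 * a1 + a2 * a2) * b2 - a2 * (a1 * b1 + a2 * b2)); last by rewrite /o; ring.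
  by rewrite AA AB; ring.
have ho : o = 1 \/ o = -1.
  have : (o - 1) * (o + 1) == 0 by apply/eqP; transitivity (o * o - 1); [ring | rewrite oo subrr].
  by rewrite mulf_eq0 subr_eq0 addr_eq0 => /orP[] /eqP ->; [left | right].
exists o, (a1, a2), (f x - lin o (a1, a2) x); split; first by [].
move=> y Ny; move: (dA y Ny) (dB y Ny).
rewrite hb1 hb2 /rigid /lin ?coordE => h1 h2.
have e1 : y.1 = x.1 + (a1 * ((f y).1 - (f x).1) + a2 * ((f y).2 - (f x).2)) by rewrite h1; ring.
have e2 : y.2 = x.2 + (- (o * a2) * ((f y).1 - (f x).1) + o * a1 * ((f y).2 - (f x).2))
  by rewrite h2; ring.
apply: pair_eq; rewrite !coordE /= e1 e2.
  transitivity ((f x).1 + (a1 * a1 + (o * o) * (a2 * a2)) * ((f y).1 - (f x).1)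
    + (1 - o * o) * (a1 * a2) * ((f y).2 - (f x).2)); last by ring.
  by rewrite oo mul1r AA; ring.
transitivity ((f x).2 + (o * o * (a1 * a1) + a2 * a2) * ((f y).2 - (f x).2)
  + (1 - o * o) * (a1 * a2) * ((f y).1 - (f x).1)); last by ring.
by rewrite oo mul1r AA; ring.
Qed.

Variable phi : R * R -> R * R.

(** The parameters are explicit so that germs at different points can be compared; [o] is the
    orientation that the parity argument follows. *)
Definition germ x o a b :=
  exists2 e : R, 0 < e & forall y, enorm (y - x) < e -> phi y = rigid o a b y.

Lemma unfolded_germ x :
  unfolded_point phi x <-> exists o a b, orth o a /\ germ x o a b.
Proof.
split.
- move=> [N [Nx hN]]; have [ o [a [b [oa h]]]] := isometry_rigid Nx hN.
  exists o, a, b; split=> //; move: (Nx) => /nbhs_enorm[e e0 he].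
  by exists e => // y /he/h.
- move=> [ o [a [b [oa [e e0 h]]]]]; exists [set y | enorm (y - x) < e]; split.
    by apply/nbhs_enorm; exists e.
  by move=> y z /h -> /h ->; apply: rigid_isometry.
Qed.

Lemma germ_open x o a b : germ x o a b ->
  exists2 e : R, 0 < e & forall y, enorm (y - x) < e -> germ y o a b.
Proof.
move=> [e e0 h]; exists e => // y ye; exists (e - enorm (y - x)); first by lra.
move=> z zy; apply: h; have := enormD (z - y) (y - x).
have -> : z - y + (y - x) = z - x by apply: pair_eq; rewrite !coordE; ring.
lra.
Qed.

Lemma rigid_unique x (e : R) o a b o' a' b' : 0 < e -> orth o a ->
  (forall y, enorm (y - x) < e -> rigid o a b y = rigid o' a' b' y) ->
  [/\ o = o', a = a' & b = b'].
Proof.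
move=> e0 [_ aa] h.
pose r := e / 2; have r0 : 0 < r by rewrite /r; lra.
have n1 : enorm ((1, 0) : R * R) = 1 by rewrite /enorm /= expr1n expr0n /= addr0 sqrtr1.
have n2 : enorm ((0, 1) : R * R) = 1 by rewrite /enorm /= expr1n expr0n /= add0r sqrtr1.
have h0 := h x; rewrite subrr enorm0 in h0; have {}h0 := h0 e0.
have h1 : lin o a (r *: ((1, 0) : R * R)) = lin o' a' (r *: ((1, 0) : R * R)).
  have e1 : x + r *: ((1, 0) : R * R) - x = r *: (1, 0) by rewrite addrC addKr.
  rewrite -e1 -(rigidB o a b) -(rigidB o' a' b') h0 h // e1 enormZ n1 gtr0_norm // /r; lra.
have h2 : lin o a (r *: ((0, 1) : R * R)) = lin o' a' (r *: ((0, 1) : R * R)).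
  have e1 : x + r *: ((0, 1) : R * R) - x = r *: (0, 1) by rewrite addrC addKr.
  rewrite -e1 -(rigidB o a b) -(rigidB o' a' b') h0 h // e1 enormZ n2 gtr0_norm // /r; lra.
have can (c d : R) : c * r = d * r -> c = d.
  by apply: mulIf; rewrite gt_eqF.
move: (congr1 fst h1) (congr1 snd h1); rewrite /lin /= => hx hy.
have sc (c d : R) : c *: (d : R^o) = c * d by [].
rewrite !sc in hx hy.
have a1 : a.1 = a'.1 by apply: can; lra.
have a2 : a.2 = a'.2 by apply: can; lra.
have ea : a = a' by apply: pair_eq.
move: (congr1 fst h2) (congr1 snd h2); rewrite /lin /= -a1 -a2 => kx ky.
rewrite !sc in kx ky.
have k1 : o * a.2 = o' * a.2 by apply: can; lra.
have k2 : o * a.1 = o' * a.1 by apply: can; lra.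
have eo : o = o'.
  by rewrite -(mulr1 o) -(mulr1 o') -aa /dot !mulrDr !mulrA k1 k2.
split=> //; move: h0; rewrite -eo -ea /rigid => /eqP.
by rewrite (can_eq (addrK _)) => /eqP.
Qed.

Lemma germ_unique x o a b o' a' b' : orth o a ->
  germ x o a b -> germ x o' a' b' -> [/\ o = o', a = a' & b = b'].
Proof.
move=> oa [e e0 h] [e' e'0 h'].
apply: (@rigid_unique x (Num.min e e')) => //; first by rewrite lt_min e0.
by move=> y; rewrite lt_min => /andP[/h <- /h' <-].
Qed.

End Rigid.

(** * Radial isometry, Lipschitz bound and homogeneity *)

Section Lipschitz.
Variable R : realType.
Implicit Types (x y z u v w p q a b : R * R) (s t k r o e : R).

Lemma scE s t : s *: (t : R^o) = s * t. Proof. by []. Qed.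

Definition seg x y t : R * R := x + t *: (y - x).

Lemma segB x y s t : seg x y s - seg x y t = (s - t) *: (y - x).
Proof. by rewrite /seg; apply: pair_eq; rewrite !coordE; ring. Qed.

Lemma seg0 x y : seg x y 0 = x.
Proof. by rewrite /seg scale0r addr0. Qed.

Lemma seg1 x y : seg x y 1 = y.
Proof. by rewrite /seg scale1r addrC subrK. Qed.

Lemma enorm_seg x y s t : enorm (seg x y s - seg x y t) = `|s - t| * enorm (y - x).
Proof. by rewrite segB enormZ. Qed.

Lemma seg_ball p e x y t : 0 <= t <= 1 -> enorm (x - p) < e -> enorm (y - p) < e ->
  enorm (seg x y t - p) < e.
Proof.
move=> /andP[t0 t1] hx hy.
have -> : seg x y t - p = (1 - t) *: (x - p) + t *: (y - p).
  by apply: pair_eq; rewrite !coordE; ring.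
apply: le_lt_trans (enormD _ _) _; rewrite !enormZ !ger0_norm //; last by lra.
set X := enorm (x - p) in hx *; set Y := enorm (y - p) in hy *.
have h1 : (1 - t) * X <= (1 - t) * Num.max X Y by apply: ler_wpM2l; [lra | rewrite le_max lexx].
have h2 : t * Y <= t * Num.max X Y by apply: ler_wpM2l; [lra | rewrite le_max lexx orbT].
have h3 : Num.max X Y < e by rewrite gt_max hx.
lra.
Qed.

Lemma enormB x y : enorm (x - y) = enorm (y - x).
Proof. by rewrite -opprB enormN. Qed.

Lemma enorm_triangle x y z : enorm (x - z) <= enorm (x - y) + enorm (y - z).
Proof.
have -> : x - z = (x - y) + (y - z) by apply: pair_eq; rewrite !coordE; ring.
exact: enormD.
Qed.

Lemma small_step (L e : R) : 0 <= L -> 0 < e ->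
  exists2 d : R, 0 < d & forall s, `|s| < d -> `|s| * L < e.
Proof.
(* [L + 1] rather than [L], since [L] may be 0. *)
move=> L0 e0; exists (e / (L + 1)); first by apply: divr_gt0 => //; lra.
move=> s; rewrite ltr_pdivlMr; last by lra.
move=> h; apply: le_lt_trans h; rewrite ler_wpM2l //; lra.
Qed.

Lemma small_step01 (L e t0 : R) : 0 <= L -> 0 < e -> 0 < t0 ->
  exists2 s : R, 0 <= s < t0 & `|s - t0| * L < e.
Proof.
move=> L0 e0 t00; have [d d0 hd] := small_step L0 e0.
pose m := Num.min (d / 2) t0.
have m0 : 0 < m by rewrite lt_min t00 andbT; lra.
have md : m <= d / 2 by rewrite ge_min lexx.
have mt : m <= t0 by rewrite ge_min lexx orbT.
exists (t0 - m); first by apply/andP; split; lra.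
by apply: hd; rewrite ltr_norml; apply/andP; split; lra.
Qed.

Variable phi : R * R -> R * R.

(** The common trace of the three types of points: near [q], each point lies with [q] in a set on
    which [phi] is distance-preserving. *)
Definition locally_radial := forall q, exists2 e : R, 0 < e &
  forall y, enorm (y - q) < e -> enorm (phi y - phi q) = enorm (y - q).

Hypothesis phi_radial : locally_radial.

(** Around each point of the segment the distances to that point are kept, so by the triangle
    inequality the bound on the distance to [phi x] passes from a parameter to its neighbours. *)
Lemma radial_lipschitz x y : enorm (phi y - phi x) <= enorm (y - x).
Proof.
pose P t := enorm (phi (seg x y t) - phi x) <= t * enorm (y - x).
have n0 := enorm_ge0 (y - x).
suff : P 1 by rewrite /P seg1 mul1r.
apply: (@real_induction R P 0 1); last by rewrite ler01 lexx.
- by rewrite /P seg0 subrr enorm0 mul0r.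
- move=> t /andP[t0 t1] h; have [e e0 he] := phi_radial (seg x y t).
  have [d d0 hd] := small_step n0 e0.
  exists d => // s /andP[ts sd]; rewrite /P.
  have hs : `|s - t| = s - t by rewrite ger0_norm // subr_ge0 ltW.
  have := h t; rewrite t0 lexx => /(_ isT); rewrite /P => Pt.
  have := he (seg x y s); rewrite enorm_seg => /(_ (hd _ _)).
  rewrite hs => /(_ (ltac:(lra))) E.
  apply: le_trans (enorm_triangle _ (phi (seg x y t)) _) _; rewrite E; lra.
- move=> t /andP[t0 t1] h; have [e e0 he] := phi_radial (seg x y t).
  have [s /andP[s0 st] sd] := small_step01 n0 e0 t0.
  have hs : `|s - t| = t - s by rewrite distrC ger0_norm // subr_ge0 ltW.
  have := he (seg x y s); rewrite enorm_seg => /(_ sd) E.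
  have := h s; rewrite s0 st => /(_ isT); rewrite /P => Ps.
  apply: le_trans (enorm_triangle _ (phi (seg x y s)) _) _.
  rewrite [enorm (phi (seg x y t) - _)]enormB E hs; lra.
Qed.

(** Equality in the triangle inequality: from [phi p], the images of [x] and [seg p x t] are at
    distances 1 and [t] times [enorm (x - p)], and by the Lipschitz bound they are at most [1 - t]
    times it apart, so they lie on one ray. *)
Lemma radial_homogeneous p e :
  (forall y, enorm (y - p) < e -> enorm (phi y - phi p) = enorm (y - p)) ->
  forall x t, enorm (x - p) < e -> 0 <= t <= 1 ->
    phi (seg p x t) - phi p = t *: (phi x - phi p).
Proof.
move=> h x t xe /andP[t0 t1].
have sx : seg p x t - p = t *: (x - p) by rewrite -[X in _ - X](seg0 p x) segB subr0.
have tn : enorm (t *: (x - p)) = t * enorm (x - p) by rewrite enormZ ger0_norm.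
have n0 := enorm_ge0 (x - p).
have h1 := h x xe.
have h2 : enorm (phi (seg p x t) - phi p) = enorm (t *: (x - p)).
  by rewrite h ?sx // tn; apply: le_lt_trans xe; rewrite ler_piMl.
have h3 : enorm (phi x - phi (seg p x t)) <= enorm ((1 - t) *: (x - p)).
  apply: le_trans (radial_lipschitz _ _) _.
  by rewrite -[X in X - _](seg1 p x) segB.
move/enorm_eq: h1; move/enorm_eq: h2; move: h3; rewrite enorm_le.
set A := phi x - phi p; set B := phi (seg p x t) - phi p.
have -> : phi x - phi (seg p x t) = A - B by rewrite /A /B; apply: pair_eq; rewrite !coordE; ring.
move: A B (x - p) => A B X; rewrite /dot !coordE => h3 h2 h1.
apply/eqP; rewrite -subr_eq0; apply/eqP; apply: dot_eq0; apply/eqP; rewrite eq_le dot_ge0 andbT.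
rewrite /dot !coordE.
set a := A.1 in h1 h2 h3 *; set a' := A.2 in h1 h2 h3 *; set b := B.1 in h1 h2 h3 *; set b' :=
  B.2 in h1 h2 h3 *.
set c := X.1 in h1 h2 h3; set c' := X.2 in h1 h2 h3.
have k : t * (c * c + c' * c') <= a * b + a' * b'. by lra.
have := ler_wpM2l t0 k.
have -> : (b - t * a) * (b - t * a) + (b' - t * a') * (b' - t * a') =
  (b * b + b' * b') + t * t * (a * a + a' * a') - 2 * (t * (a * b + a' * b')) by ring.
rewrite h2 h1; lra.
Qed.

(** Conjugation by the homothety of center [p] and ratio [t] keeps the linear part [o], [a] and
    changes only the translation, which is therefore existentially quantified. *)
Lemma germ_homogeneous p e :
  (forall y, enorm (y - p) < e -> enorm (phi y - phi p) = enorm (y - p)) ->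
  forall x t o a, enorm (x - p) < e -> 0 < t <= 1 ->
    (exists b, germ phi x o a b) <-> (exists b, germ phi (seg p x t) o a b).
Proof.
move=> h x t o a xe /andP[t0 t1]; have H := radial_homogeneous h.
have t01 : 0 <= t <= 1 by rewrite ltW.
have tV : t * t^-1 = 1 by rewrite mulfV // gt_eqF.
split.
- move=> [b [e' e'0 g]]; exists (phi p + t *: (b - phi p) + lin o a ((t - 1) *: p)).
  pose e2 := Num.min e' (e - enorm (x - p)).
  have e20 : 0 < e2 by rewrite lt_min e'0 subr_gt0.
  exists (t * e2); first by apply: mulr_gt0.
  move=> y; have [y' ->] : exists y', y = seg p y' t.
    exists (p + t^-1 *: (y - p)).
    by rewrite /seg addrAC subrr add0r scalerA tV scale1r addrC subrK.
  move=> ye.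
  have yx : enorm (y' - x) < e2.
    move: ye; have -> : seg p y' t - seg p x t = t *: (y' - x).
      by rewrite /seg; apply: pair_eq; rewrite !coordE; ring.
    by rewrite enormZ gtr0_norm // ltr_pM2l.
  move: yx; rewrite lt_min => /andP[y1 y2].
  have := H y' t; rewrite t01 => /(_ _ isT) E.
  have {}E := E (ltac:(have := enorm_triangle y' x p; lra)).
  have -> : phi (seg p y' t) = phi p + t *: (phi y' - phi p) by rewrite -E addrC subrK.
  by rewrite (g y') // /rigid /lin /seg; apply: pair_eq; rewrite !coordE /= ?coordE ?scE; ring.
- move=> [b [e' e'0 g]]; exists (phi p + t^-1 *: (b - phi p) + lin o a (t^-1 *: (p - t *: p))).
  pose e2 := Num.min e' (e - enorm (x - p)).
  have e20 : 0 < e2 by rewrite lt_min e'0 subr_gt0.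
  exists e2 => // y; rewrite lt_min => /andP[y1 y2].
  have := H y t; rewrite t01 => /(_ _ isT) E.
  have {}E := E (ltac:(have := enorm_triangle y x p; lra)).
  have yx : enorm (seg p y t - seg p x t) < e'.
    have -> : seg p y t - seg p x t = t *: (y - x).
      by rewrite /seg; apply: pair_eq; rewrite !coordE; ring.
    rewrite enormZ gtr0_norm //; apply: le_lt_trans y1; rewrite ler_piMl // enorm_ge0 //.
  have -> : phi y = phi p + t^-1 *: (phi (seg p y t) - phi p).
    by rewrite E scalerA mulrC tV scale1r addrC subrK.
  rewrite (g (seg p y t)) // /rigid /lin /seg; apply: pair_eq; rewrite !coordE /= ?coordE ?scE;
    field; exact: lt0r_neq0.
Qed.
End Lipschitz.

(** * Continuation of isometries *)

Section Continuation.
Variable R : realType.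
Implicit Types (x y z u v w p q a b : R * R) (s t k r o e : R).
Variable phi : R * R -> R * R.

Lemma germ_at x o a b : germ phi x o a b -> phi x = rigid o a b x.
Proof. by move=> [e e0]; apply; rewrite subrr enorm0. Qed.

Lemma unfolded_open x : unfolded_point phi x ->
  exists2 e : R, 0 < e & forall y, enorm (y - x) < e -> unfolded_point phi y.
Proof.
move=> /unfolded_germ[ o [a [b [oa /germ_open[e e0 h]]]]].
by exists e => // y /h ?; apply/unfolded_germ; exists o, a, b.
Qed.

(** Germs are open and unique, so the isometry is locally constant along unfolded points, and real
    induction carries it to [y]. *)
Lemma germ_segment x y o a b : orth o a ->
  (forall t, 0 <= t <= 1 -> unfolded_point phi (seg x y t)) ->
  germ phi x o a b -> germ phi y o a b.
Proof.
move=> oa unf gx; have n0 := enorm_ge0 (y - x).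
pose P t := germ phi (seg x y t) o a b.
suff : P 1 by rewrite /P seg1.
apply: (@real_induction R P 0 1); last by rewrite ler01 lexx.
- by rewrite /P seg0.
- move=> t /andP[t0 t1] h; have := h t; rewrite t0 lexx => /(_ isT) /germ_open[e e0 he].
  have [d d0 hd] := small_step n0 e0.
  exists d => // s /andP[ts sd]; apply: he; rewrite enorm_seg; apply: hd.
  by rewrite ger0_norm ?subr_ge0 ?ltW //; lra.
- move=> t /andP[t0 t1] h; have /unf/unfolded_germ[ o' [a' [b' [oa' gt]]]] : 0 <= t <= 1
    by rewrite ltW.
  have [e e0 he] := germ_open gt.
  have [s /andP[s0 st] sd] := small_step01 n0 e0 t0.
  have := h s; rewrite s0 st => /(_ isT) gs.
  have := he (seg x y s); rewrite enorm_seg => /(_ sd) gs'.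
  by have [eo ea eb] := germ_unique oa gs gs'; rewrite /P eo ea eb.
Qed.

Lemma isometry_enorm (f : R * R -> R * R) : preserves_dist_on setT f ->
  forall x y, enorm (f x - f y) = enorm (x - y).
Proof. by move=> h x y; apply: h. Qed.

Hypothesis phi_radial : locally_radial phi.

(** [phi] cannot jump from [f] to [g]: if it takes the value of one at [t] and of the other at [s],
    the Lipschitz bound makes the gap between [f] and [g] at [t] at most twice the distance
    travelled, while this gap is positive. *)
Lemma separation x y f g :
  preserves_dist_on setT f -> preserves_dist_on setT g ->
  (forall t, 0 <= t <= 1 -> phi (seg x y t) = f (seg x y t) \/ phi (seg x y t) = g (seg x y t)) ->
  (forall t, 0 <= t <= 1 -> f (seg x y t) <> g (seg x y t)) ->
  phi x = f x -> phi y = f y.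
Proof.
move=> /isometry_enorm hf /isometry_enorm hg fg neq fx; have n0 := enorm_ge0 (y - x).
pose P t := phi (seg x y t) = f (seg x y t).
have gap t s : 0 <= t <= 1 -> phi (seg x y t) = f (seg x y t) -> phi (seg x y s) = g (seg x y s) ->
    enorm (f (seg x y t) - g (seg x y t)) <= 2 * (`|s - t| * enorm (y - x)).
  move=> t01 ft gs; apply: le_trans (enorm_triangle _ (g (seg x y s)) _) _.
  rewrite hg -ft -gs; have := radial_lipschitz phi_radial (seg x y s) (seg x y t).
  by rewrite !enorm_seg distrC; lra.
have gap' t s : 0 <= t <= 1 -> phi (seg x y t) = g (seg x y t) -> phi (seg x y s) = f (seg x y s) ->
    enorm (f (seg x y t) - g (seg x y t)) <= 2 * (`|s - t| * enorm (y - x)).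
  move=> t01 ft gs; apply: le_trans (enorm_triangle _ (f (seg x y s)) _) _.
  rewrite hf -ft -gs; have := radial_lipschitz phi_radial (seg x y t) (seg x y s).
  by rewrite !enorm_seg distrC; lra.
suff : P 1 by rewrite /P seg1.
apply: (@real_induction R P 0 1); last by rewrite ler01 lexx.
- by rewrite /P seg0.
- move=> t /andP[t0 t1] h; have := h t; rewrite t0 lexx => /(_ isT) ft.
  have t01 : 0 <= t <= 1 by rewrite t0 ltW.
  have D0 : 0 < enorm (f (seg x y t) - g (seg x y t)).
    by apply: enorm_gt0 => /eqP; rewrite subr_eq0 => /eqP /(neq t t01).
  have D20 : 0 < enorm (f (seg x y t) - g (seg x y t)) / 2 by lra.
  have [d d0 hd] := small_step n0 D20.
  exists (Num.min d (1 - t)); first by rewrite lt_min d0 subr_gt0.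
  move=> s /andP[ts]; rewrite -ltrBlDl lt_min => /andP[sd s1].
  have s01 : 0 <= s <= 1 by apply/andP; split; lra.
  case: (fg s s01) => [//|gs].
  have := gap t s t01 ft gs.
  have : `|s - t| * enorm (y - x) < enorm (f (seg x y t) - g (seg x y t)) / 2.
    by apply: hd; rewrite gtr0_norm ?subr_gt0.
  by move=> h1 h2; exfalso; clear - h1 h2; lra.
- move=> t /andP[t0 t1] h; have t01 : 0 <= t <= 1 by rewrite ltW.
  case: (fg t t01) => [//|gt].
  have D0 : 0 < enorm (f (seg x y t) - g (seg x y t)).
    by apply: enorm_gt0 => /eqP; rewrite subr_eq0 => /eqP /(neq t t01).
  have D20 : 0 < enorm (f (seg x y t) - g (seg x y t)) / 2 by lra.
  have [s /andP[s0 st] sd] := small_step01 n0 D20 t0.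
  have := h s; rewrite s0 st => /(_ isT) fs.
  have h1 := gap' t s t01 gt fs; exfalso; clear - h1 sd; lra.
Qed.

Lemma rigid_surj o a b y : orth o a -> exists x, rigid o a b x = y.
Proof.
move=> [ho]; rewrite /dot => aa.
have oo : o * o = 1 by case: ho => ->; ring.
exists (a.1 * (y.1 - b.1) + a.2 * (y.2 - b.2), o * (- a.2 * (y.1 - b.1) + a.1 * (y.2 - b.2))).
apply: pair_eq; rewrite /rigid !coordE /=.
  transitivity (b.1 + (a.1 * a.1 + o * o * (a.2 * a.2)) * (y.1 - b.1)
    + (1 - o * o) * (a.1 * a.2) * (y.2 - b.2)).
    by ring.
  by rewrite oo mul1r aa; ring.
transitivity (b.2 + (o * o * (a.1 * a.1) + a.2 * a.2) * (y.2 - b.2)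
  + (1 - o * o) * (a.1 * a.2) * (y.1 - b.1)).
  by ring.
by rewrite oo mul1r aa; ring.
Qed.

Definition refl p u y : R * R := y - (2 * dot (y - p) u / dot u u) *: u.

Lemma refl_isometry p u x y : u <> 0 -> enorm (refl p u x - refl p u y) = enorm (x - y).
Proof.
move=> /dot_gt0 u0; apply/enorm_eq.
have uV : dot u u / dot u u = 1 by rewrite mulfV // gt_eqF.
move: uV; rewrite /refl; set c := (dot u u)^-1 => uV.
transitivity (dot (x - y) (x - y) + 4 * (dot (x - y) u) ^+ 2 * c * (dot u u * c - 1)).
  by rewrite /dot !coordE; ring.
by rewrite uV subrr mulr0 addr0.
Qed.

(** The norm and the component along [perp u] leave only the sign of the component along [u] free;
    the second case is the mirror image. *)
Lemma two_sphere u Z Y : u <> 0 -> dot Z Z = dot Y Y -> dot Z (perp u) = dot Y (perp u) ->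
  Z = Y \/ Z = Y - (2 * dot Y u / dot u u) *: u.
Proof.
move=> /dot_gt0 u0 h1 h2.
have uV : dot u u / dot u u = 1 by rewrite mulfV // gt_eqF.
have L v : dot v v * dot u u = dot v u ^+ 2 + dot v (perp u) ^+ 2.
  by rewrite /dot /=; ring.
have E v : v = (dot u u)^-1 *: (dot v u *: u + dot v (perp u) *: perp u).
  have : v = (dot u u / dot u u) *: v by rewrite uV scale1r.
  move=> {1}->; rewrite mulrC -scalerA; congr (_ *: _).
  by apply: pair_eq; rewrite !coordE /dot /=; ring.
have : dot Z u ^+ 2 == dot Y u ^+ 2.
  by apply/eqP; have := L Z; have := L Y; rewrite h1 h2 => -> /eqP;
    rewrite -subr_eq0 opprD addrACA subrr addr0 subr_eq0 => /eqP ->.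
rewrite eqf_sqr => /orP[] /eqP hu.
  by left; rewrite (E Z) (E Y) hu h2.
right; rewrite (E Z) {1}(E Y) hu h2.
move: (dot Y u) (dot Y (perp u)) (dot u u)^-1 => A B C.
by apply: pair_eq; rewrite !coordE /=; ring.
Qed.

Lemma vertex_crease_direction p e u : vertex_point phi p -> u <> 0 -> 0 < e ->
  (forall y, enorm (y - p) < e -> enorm (phi y - phi p) = enorm (y - p)) ->
  exists x, [/\ enorm (x - p) < e, 0 < dot (x - p) u & ~ unfolded_point phi x].
Proof.
move=> [nunf ncr _] u0' e0 hrad; apply: contrapT => nex.
have unf' x : enorm (x - p) < e -> 0 < dot (x - p) u -> unfolded_point phi x.
  by move=> xe xu; apply: contrapT => h; apply: nex; exists x.
have [k k0 ke] : exists2 k : R, 0 < k & enorm (k *: u) < e.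
  have [d d0 hd] := small_step (enorm_ge0 u) e0.
  exists (d / 2); first by lra.
  by rewrite enormZ; apply: hd; rewrite gtr0_norm; lra.
have : k *: u <> 0.
  by move=> /eqP; rewrite scaler_eq0 (gt_eqF k0) /= => /eqP.
(* [u] is rescaled to be shorter than [e], so that [p + u] and [p - u] are base points of the two
   half discs. *)
have {unf'} : forall x, enorm (x - p) < e -> 0 < dot (x - p) (k *: u) -> unfolded_point phi x.
  move=> x xe; have -> : dot (x - p) (k *: u) = k * dot (x - p) u by rewrite /dot !coordE; ring.
  by rewrite pmulr_rgt0 // => /(unf' _ xe).
move: (k *: u) ke => {u0' nex k k0} {}u ue unf u0.
have uu := dot_gt0 u0.
have pu : p + u - p = u by rewrite addrC addKr.
have /unfolded_germ[ o [a [b [oa g0]]]] : unfolded_point phi (p + u).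
  by apply: unf; rewrite pu.
pose f := rigid o a b; have fiso := rigid_isometry b oa; have fn := isometry_enorm fiso.
have dseg x y t : dot (seg x y t - p) u = (1 - t) * dot (x - p) u + t * dot (y - p) u.
  by rewrite /dot !coordE; ring.
have dseg_gt x y t : 0 <= t <= 1 -> 0 < dot (x - p) u -> 0 < dot (y - p) u ->
  0 < dot (seg x y t - p) u.
  move=> /andP[t0 t1]; rewrite dseg; set A := dot _ _; set B := dot _ _ => A0 B0.
  have [->|t0'] := eqVneq t 0; first by lra.
  have tB : 0 < t * B by apply: mulr_gt0 => //; rewrite lt_neqAle eq_sym t0' t0.
  have : 0 <= (1 - t) * A by apply: mulr_ge0; lra.
  lra.
have dseg_lt x y t : 0 <= t <= 1 -> dot (x - p) u < 0 -> dot (y - p) u < 0 ->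
  dot (seg x y t - p) u < 0.
  move=> /andP[t0 t1]; rewrite dseg; set A := dot _ _; set B := dot _ _ => A0 B0.
  have [->|t0'] := eqVneq t 0; first by lra.
  have tB : 0 < t * - B by apply: mulr_gt0; [rewrite lt_neqAle eq_sym t0' t0 | lra].
  have : 0 <= (1 - t) * - A by apply: mulr_ge0; lra.
  lra.
have up x : enorm (x - p) < e -> 0 < dot (x - p) u -> phi x = f x.
  move=> xe xu; apply: germ_at; apply: germ_segment g0 => // t t01; apply: unf.
    by apply: seg_ball; rewrite ?pu.
  by apply: dseg_gt; rewrite ?pu.
(* The bounding line is reached by continuity: [x'] is [x] pushed slightly into the half disc. *)
have upc x : enorm (x - p) < e -> 0 <= dot (x - p) u -> phi x = f x.
  move=> xe xu; apply: contrapT => neq.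
  have D0 : 0 < enorm (phi x - f x).
    by apply: enorm_gt0 => /eqP; rewrite subr_eq0 => /eqP.
  have D1 : 0 < Num.min (enorm (phi x - f x) / 2) (e - enorm (x - p)).
    by rewrite lt_min subr_gt0 xe andbT; lra.
  have [d d0 hd] := small_step (enorm_ge0 u) D1.
  pose x' := x + (d / 2) *: u.
  have x'x : x' - x = (d / 2) *: u by rewrite /x' addrC addKr.
  have : enorm (x' - x) < Num.min (enorm (phi x - f x) / 2) (e - enorm (x - p)).
    by rewrite x'x enormZ; apply: hd; rewrite gtr0_norm; lra.
  rewrite lt_min => /andP[h1 h2].
  have fx' : phi x' = f x'.
    apply: up; first by have := enorm_triangle x' x p; lra.
    have -> : dot (x' - p) u = dot (x - p) u + d / 2 * dot u u by rewrite /x' /dot !coordE; ring.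
    have : 0 < d / 2 * dot u u by apply: mulr_gt0; lra.
    lra.
  have := enorm_triangle (phi x) (phi x') (f x); rewrite [X in _ + enorm (X - _)]fx' fn.
  have := radial_lipschitz phi_radial x' x; rewrite [enorm (x - x')]enormB => h3 h4; exfalso;
    clear - h1 h3 h4; lra.
pose g := f \o refl p u.
have giso : preserves_dist_on setT g.
  by move=> x y _ _; rewrite !edistE /g /= fn refl_isometry.
have phip : phi p = f p by apply: upc; rewrite subrr ?enorm0 // /dot !coordE !mul0r addr0.
(* Let [z] be the preimage of [phi y] by [f]. It is as far from [p] as [y], and no farther than [y]
   from the points [p + perp u] and [p - perp u], at which [phi] agrees with [f]. The two
   inequalities force equal components along [perp u], so [z] is [y] or its mirror image. *)
have low y : enorm (y - p) < e -> phi y = f y \/ phi y = g y.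
  move=> ye; have [z fz] := rigid_surj b (phi y) oa.
  have pun : enorm (perp u) = enorm u by apply/enorm_eq; rewrite /dot /=; ring.
  have w1 : phi (p + perp u) = f (p + perp u).
    apply: upc; first by rewrite [p + _]addrC addrK pun.
    by rewrite [p + _]addrC addrK /dot /=; lra.
  have w2 : phi (p - perp u) = f (p - perp u).
    apply: upc; first by rewrite [p - _]addrC addrK enormN pun.
    by rewrite [p - _]addrC addrK /dot /=; lra.
  have h0 := hrad _ ye; rewrite phip -fz fn in h0.
  have h1 := radial_lipschitz phi_radial (p + perp u) y; rewrite w1 -fz fn in h1.
  have h2 := radial_lipschitz phi_radial (p - perp u) y; rewrite w2 -fz fn in h2.
  have s1 x : x - (p + perp u) = (x - p) - perp u by rewrite opprD addrA.
  have s2 x : x - (p - perp u) = (x - p) + perp u by rewrite opprB addrA addrAC.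
  rewrite !s1 !enorm_le in h1; rewrite !s2 !enorm_le in h2; move/enorm_eq in h0.
  have hd : dot (z - p) (perp u) = dot (y - p) (perp u).
    move: h0 h1 h2; move: (z - p) (y - p) (perp u) => Z Y W.
    by rewrite /dot !coordE => h0 h1 h2; apply/eqP; rewrite eq_le; apply/andP; split; lra.
  have [hz|hz] := two_sphere u0 h0 hd.
    left; rewrite -fz; congr (rigid _ _ _ _).
    by move/eqP: hz; rewrite (can_eq (addrNK _)) => /eqP.
  right; rewrite -fz /g /= /f; congr (rigid _ _ _ _).
  by rewrite /refl -[z](subrK p) hz addrAC subrK.
have neq y : dot (y - p) u < 0 -> f y <> g y.
  move=> yu fg; have : enorm (f y - f (refl p u y)) = 0 by rewrite {1}fg subrr enorm0.
  rewrite fn => /enorm_eq0; rewrite /refl opprB addrC subrK => /eqP.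
  rewrite scaler_eq0 !mulf_eq0 invr_eq0 !(gt_eqF uu) (lt_eqF yu) pnatr_eq0 /= => /eqP.
  exact: u0.
have pu' : p - u - p = - u by rewrite addrC addKr.
have y0u : dot (p - u - p) u < 0.
  rewrite pu'; have -> : dot (- u) u = - dot u u by rewrite /dot !coordE; ring.
  by rewrite oppr_lt0.
have y0e : enorm (p - u - p) < e by rewrite pu' enormN.
(* The lower half disc is convex and [f], [g] differ on it, so the choice made at [p - u] holds
   throughout. [F] and [G] are [f] and [g] in either order. *)
have all_low F G : preserves_dist_on setT F -> preserves_dist_on setT G ->
    (forall y, enorm (y - p) < e -> phi y = F y \/ phi y = G y) ->
    (forall y, dot (y - p) u < 0 -> F y <> G y) -> phi (p - u) = F (p - u) ->
    forall y, enorm (y - p) < e -> dot (y - p) u < 0 -> phi y = F y.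
  move=> hF hG FG nFG F0 y ye yu; apply: (separation hF hG) F0 => t t01.
    by apply: FG; apply: seg_ball.
  by apply: nFG; apply: dseg_lt.
have [c0|c0] := low _ y0e.
  apply: nunf; apply/unfolded_germ; exists o, a, b; split=> //; exists e => // y ye.
  have [h|h] := leP 0 (dot (y - p) u); first exact: upc.
  exact: (all_low f g).
apply: ncr; split=> //.
(* [p] is added to the second piece because both pieces must contain it. *)
exists [set y | enorm (y - p) < e], [set y | enorm (y - p) < e /\ 0 <= dot (y - p) u],
  [set y | enorm (y - p) < e /\ (dot (y - p) u < 0 \/ y = p)], f, g.
have pe : enorm (p - p) < e by rewrite subrr enorm0.
split.
- by apply/nbhs_enorm; exists e.
- apply/seteqP; split=> y /=; last by case=> [[]|[]].
  by move=> ye; have [h|h] := leP 0 (dot (y - p) u); [left | right; split => //; left].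
- by split=> /=; split => //; [rewrite subrr /dot !coordE !mul0r addr0 | right].
- split; split=> //; first by move=> y [ye]; apply: upc.
  move=> y [ye [yu|->]].
    apply: (all_low g f) => // [z ze|z zu fg]; first by case: (low z ze); [right|left].
    by apply: (neq z zu).
  by rewrite phip /g /= /refl subrr /dot !coordE !mul0r addr0 mulr0 mul0r scale0r subr0.
- by move=> fg; apply: (neq _ y0u); rewrite fg.
Qed.

End Continuation.

(** * Crease points *)

Section Crease.
Variable R : realType.
Implicit Types (x y z u v w p q a b d : R * R) (s t k r o e : R).
Variable phi : R * R -> R * R.

Lemma cover_radial q (I : Type) (N : set (R * R)) (A : I -> set (R * R)) (f : I -> R * R -> R * R) :
  nbhs q N -> (forall x, N x -> exists i, A i x) -> (forall i, A i q) ->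
  (forall i, maps_by phi (A i) (f i)) ->
  exists2 e : R, 0 < e & forall y, enorm (y - q) < e -> enorm (phi y - phi q) = enorm (y - q).
Proof.
move=> /nbhs_enorm[e e0 he] cov Aq fA; exists e => // y /he/cov[i Ai].
have [/isometry_enorm fi hi] := fA i.
by rewrite (hi y) // (hi q).
Qed.

Lemma folding_radial : local_flat_folding phi -> locally_radial phi.
Proof.
move=> [_ types _] q; case: (types q).
- move=> [N [/nbhs_enorm[e e0 he] hN]]; exists e => // y /he Ny.
  by apply: hN => //; apply: he; rewrite subrr enorm0.
- move=> [_ [N [A [B [f [g [Nq NE [Aq Bq] [fA gB] _]]]]]]].
  apply: (@cover_radial q bool N (fun i => if i then A else B) (fun i => if i then f else g)) => //.
  + by move=> x; rewrite NE => -[?|?]; [exists true | exists false].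
  + by case.
  + by case.
- move=> [_ _ [N [n [A [f [Nq [_ NE] Aq fA _]]]]]].
  apply: (@cover_radial q _ N A f) => //.
  by move=> x; rewrite NE => -[i _ ?]; exists i.
Qed.

Hypothesis phi_radial : locally_radial phi.

Lemma segr p x y t : seg x y t - p = (1 - t) *: (x - p) + t *: (y - p).
Proof. by apply: pair_eq; rewrite !coordE; ring. Qed.

Lemma cross_le d v : `|cross d v| <= enorm d * enorm v.
Proof.
have h : 0 <= enorm d * enorm v by rewrite mulr_ge0 ?enorm_ge0.
rewrite le_sqr_sqrt ?normr_ge0 // real_normK ?num_real // exprMn !enorm_sq.
rewrite -subr_ge0; have -> : dot d d * dot v v - cross d v ^+ 2 = dot d v ^+ 2.
  by rewrite /cross /dot; ring.
exact: sqr_ge0.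
Qed.

Lemma cross_stable d q x : cross d (x - q) != 0 -> exists2 e : R, 0 < e &
  forall y, enorm (y - x) < e -> 0 < cross d (y - q) * cross d (x - q).
Proof.
set c := cross d (x - q) => c0.
have nc : 0 < `|c| by rewrite normr_gt0.
have [e e0 he] := small_step (enorm_ge0 d) nc.
exists e => // y ye.
have yx : `|cross d (y - x)| < `|c|.
  apply: le_lt_trans (cross_le _ _) _; rewrite mulrC.
  by have := he (enorm (y - x)); rewrite ger0_norm ?enorm_ge0 //; apply.
have -> : cross d (y - q) = c + cross d (y - x) by rewrite /c /cross !coordE; ring.
move: yx; rewrite ltr_norml => /andP[h1 h2].
have [cp|cn] : 0 < c \/ c < 0.
  by move: c0; rewrite neq_lt => /orP[]; [right|left].
  by apply: mulr_gt0 => //; rewrite gtr0_norm // in h1; lra.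
by rewrite nmulr_lgt0 //; rewrite ltr0_norm // in h2; lra.
Qed.

(** The punctured disc is connected but not convex, so [separation] is applied only on segments that
    miss [q], between points seen from [q] at an angle that is not obtuse. *)
Lemma rigid_alternative_punctured q e o a b o' a' b' : 0 < e -> orth o a -> orth o' a' ->
  (forall x, enorm (x - q) < e -> phi x = rigid o a b x \/ phi x = rigid o' a' b' x) ->
  (forall x, x <> q -> rigid o a b x <> rigid o' a' b' x) ->
  (exists2 y, 0 < enorm (y - q) < e & phi y = rigid o a b y) ->
  forall x, x <> q -> enorm (x - q) < e -> phi x = rigid o a b x.
Proof.
move=> e0 oa oa' alt neq [y /andP[y0 ye] fy] x xq xe.
have step z w : 0 < dot (z - q) (z - q) -> 0 < dot (w - q) (w - q) -> 0 <= dot (z - q) (w - q) ->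
    enorm (z - q) < e -> enorm (w - q) < e ->
    phi z = rigid o a b z -> phi w = rigid o a b w.
  move=> z0 w0 zw ze we;
    apply: (separation phi_radial (rigid_isometry b oa) (rigid_isometry b' oa')) => t t01.
    by apply: alt; apply: seg_ball.
  apply: neq => /eqP; rewrite -subr_eq0 segr => /eqP h.
  move/andP: t01 => [t0 t1].
  have : dot ((1 - t) *: (z - q) + t *: (w - q)) (w - q) = 0 by rewrite h /dot !coordE !mul0r addr0.
  have : dot ((1 - t) *: (z - q) + t *: (w - q)) (z - q) = 0 by rewrite h /dot !coordE !mul0r addr0.
  have -> : dot ((1 - t) *: (z - q) + t *: (w - q)) (z - q) = (1 - t) * dot (z - q) (z - q)
    + t * dot (z - q) (w - q).
    by rewrite /dot !coordE; ring.
  have -> : dot ((1 - t) *: (z - q) + t *: (w - q)) (w - q) = (1 - t) * dot (z - q) (w - q)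
    + t * dot (w - q) (w - q).
    by rewrite /dot !coordE; ring.
  move: (dot (z - q) (z - q)) (dot (w - q) (w - q)) (dot (z - q) (w - q)) z0 w0 zw =>
    A B C A0 B0 C0 h1 h2.
  have k1 : 0 <= (1 - t) * A by apply: mulr_ge0; lra.
  have k2 : 0 <= (1 - t) * C by apply: mulr_ge0; lra.
  have k3 : 0 <= t * C by apply: mulr_ge0; lra.
  have k4 : 0 <= t * B by apply: mulr_ge0; lra.
  have : (1 - t) * A = 0 by lra.
  have : t * B = 0 by lra.
  move=> /eqP; rewrite mulf_eq0 (gt_eqF B0) orbF => /eqP ->.
  by rewrite subr0 mul1r => A00; rewrite A00 ltxx in A0.
have dd v : dot v v = enorm v ^+ 2 by rewrite enorm_sq.
have y00 : 0 < dot (y - q) (y - q) by rewrite dd exprn_gt0.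
have x00 : 0 < dot (x - q) (x - q).
  by apply: dot_gt0 => /eqP; rewrite subr_eq0 => /eqP.
have [h|h] := leP 0 (dot (y - q) (x - q)); first exact: (step y).
have pn v : enorm (perp v) = enorm v by apply/enorm_eq; rewrite /dot /=; ring.
have pq v : q + v - q = v by rewrite addrC addKr.
have pd v : dot (perp v) (perp v) = dot v v by rewrite /dot /=; ring.
have pc v : dot v (perp v) = 0 by rewrite /dot /=; ring.
(* If [x] is at an obtuse angle from [y], two quarter turns lead from [y] to its opposite, which is
   at an acute angle from [x]. *)
have f1 : phi (q + perp (y - q)) = rigid o a b (q + perp (y - q)).
  by apply: (step y); rewrite ?pq ?pn ?pd ?pc.
have f2 : phi (q + perp (perp (y - q))) = rigid o a b (q + perp (perp (y - q))).
  by apply: (step (q + perp (y - q))); rewrite ?pq ?pn ?pd ?pc.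
apply: (step (q + perp (perp (y - q)))); rewrite ?pq ?pn ?pd //.
have -> : dot (perp (perp (y - q))) (x - q) = - dot (y - q) (x - q) by rewrite /dot /=; ring.
by rewrite oppr_ge0 ltW.
Qed.

(** The half disc is convex, so by [separation] a single point decides. *)
Lemma rigid_half q e o a b o' a' b' d : 0 < e -> orth o a -> orth o' a' ->
  (forall x, enorm (x - q) < e -> phi x = rigid o a b x \/ phi x = rigid o' a' b' x) ->
  (forall x, 0 < cross d (x - q) -> rigid o a b x <> rigid o' a' b' x) ->
  (forall x, enorm (x - q) < e -> 0 < cross d (x - q) -> phi x = rigid o a b x) \/
  (forall x, enorm (x - q) < e -> 0 < cross d (x - q) -> phi x = rigid o' a' b' x).
Proof.
move=> e0 oa oa' alt neq.
have cseg x y t : 0 <= t <= 1 -> 0 < cross d (x - q) -> 0 < cross d (y - q) ->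
  0 < cross d (seg x y t - q).
  move=> /andP[t0 t1].
  have -> : cross d (seg x y t - q) = (1 - t) * cross d (x - q) + t * cross d (y - q).
    by rewrite /cross !coordE; ring.
  set A := cross _ _; set B := cross _ _ => A0 B0.
  have [->|t0'] := eqVneq t 0; first by lra.
  have tB : 0 < t * B by apply: mulr_gt0 => //; rewrite lt_neqAle eq_sym t0' t0.
  have : 0 <= (1 - t) * A by apply: mulr_ge0; lra.
  lra.
have [[y [ye yc fy]]|none] :=
  pselect (exists y, [/\ enorm (y - q) < e, 0 < cross d (y - q) & phi y = rigid o a b y]).
  left=> x xe xc.
  apply: (separation phi_radial (rigid_isometry b oa) (rigid_isometry b' oa')) fy => t t01.
    by apply: alt; apply: seg_ball.
  by apply: neq; apply: cseg.
by right=> x xe xc; have [h|//] := alt x xe; exfalso; apply: none; exists x.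
Qed.

Lemma lin_perp o a v : o * o = 1 -> lin o a (perp v) = o *: perp (lin o a v).
Proof.
move=> osq; apply: pair_eq; rewrite !coordE /= ?coordE /=.
  transitivity (- o * a.2 * v.1 - (o * o) * (a.1 * v.2)); last by ring.
  by rewrite osq; ring.
transitivity (o * a.1 * v.1 - (o * o) * (a.2 * v.2)); last by ring.
by rewrite osq; ring.
Qed.

Lemma linD o a u v : lin o a (u + v) = lin o a u + lin o a v.
Proof. by apply: pair_eq; rewrite !coordE /=; ring. Qed.

Lemma linZ o a t v : lin o a (t *: v) = t *: lin o a v.
Proof. by apply: pair_eq; rewrite !coordE /= ?coordE ?scE; ring. Qed.

(** The difference of two linear isometries of opposite orientations is singular. The two witnesses
    are kernel vectors of the rows of its matrix, the second being used when the first vanishes. *)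
Lemma common_axis o a a' : orth o a -> orth (- o) a' ->
  exists2 d, d <> 0 & lin o a d = lin (- o) a' d.
Proof.
move=> [ho]; rewrite /dot => aa [_]; rewrite /dot => aa'.
have osq : o * o = 1 by case: ho => ->; ring.
have [h|h] := pselect ((a.1 + a'.1, o * (a'.2 - a.2)) = 0 :> R * R); last first.
  exists (a.1 + a'.1, o * (a'.2 - a.2)) => //; apply: pair_eq => /=.
    transitivity (a.1 * a.1 + a.1 * a'.1 - o * o * (a.2 * a'.2 - a.2 * a.2)); first by ring.
    transitivity (a'.1 * a'.1 + a.1 * a'.1 + o * o * (a'.2 * a'.2 - a.2 * a'.2)); last by ring.
    by rewrite osq; lra.
  transitivity (a.2 * (a.1 + a'.1) + o * o * (a.1 * (a'.2 - a.2))); first by ring.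
  transitivity (a'.2 * (a.1 + a'.1) - o * o * (a'.1 * (a'.2 - a.2))); last by ring.
  by rewrite osq; ring.
exists (a.2 + a'.2, o * (a.1 - a'.1)).
  move=> h'; have h1 : a.1 + a'.1 = 0 := congr1 fst h; have h2 : a.2 + a'.2 = 0 := congr1 fst h'.
  have h3 : o * (a'.2 - a.2) = 0 := congr1 snd h; have h4 : o * (a.1 - a'.1) = 0 := congr1 snd h'.
  have h5 : a'.2 - a.2 = 0 by rewrite -[LHS]mul1r -osq -mulrA h3 mulr0.
  have h6 : a.1 - a'.1 = 0 by rewrite -[LHS]mul1r -osq -mulrA h4 mulr0.
  have k1 : a.1 = 0 by lra.
  have k2 : a.2 = 0 by lra.
  by move: aa; rewrite k1 k2 mulr0 addr0 => /eqP; rewrite eq_sym oner_eq0.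
apply: pair_eq => /=.
  transitivity (a.1 * (a.2 + a'.2) - o * o * (a.2 * (a.1 - a'.1))); first by ring.
  transitivity (a'.1 * (a.2 + a'.2) + o * o * (a'.2 * (a.1 - a'.1))); last by ring.
  by rewrite osq; ring.
transitivity (a.2 * a.2 + a.2 * a'.2 + o * o * (a.1 * a.1 - a.1 * a'.1)); first by ring.
transitivity (a'.2 * a'.2 + a.2 * a'.2 - o * o * (a'.1 * a.1 - a'.1 * a'.1)); last by ring.
by rewrite osq; lra.
Qed.

(** The maps agree on [d], hence are opposite on [perp d] by [lin_perp], so agreement at [v] kills
    its component along [perp d]. *)
Lemma lin_off_axis o a a' d v : orth o a -> orth (- o) a' -> d <> 0 ->
  lin o a d = lin (- o) a' d -> lin o a v = lin (- o) a' v -> cross d v = 0.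
Proof.
move=> oa [ho' _] d0 hd hv; have [ho _] := oa.
have osq : o * o = 1 by case: ho => ->; ring.
have osq' : - o * - o = 1 by rewrite mulrNN.
have dd := dot_gt0 d0.
have E : dot d d *: v = dot d v *: d + cross d v *: perp d.
  by rewrite /dot /cross; apply: pair_eq; rewrite !coordE /=; ring.
have E1 := congr1 (lin o a) E; have E2 := congr1 (lin (- o) a') E.
rewrite !linD !linZ (lin_perp _ _ osq) in E1; rewrite !linD !linZ (lin_perp _ _ osq') in E2.
rewrite -hd -hv E1 in E2; move/addrI/eqP: E2.
rewrite -subr_eq0 -scalerBr -scalerBl scalerA scaler_eq0 !mulf_eq0.
have -> : o - - o = o + o by rewrite opprK.
case/orP=> [/orP[/eqP //|/eqP ho2]|/eqP hp].
  by exfalso; case: ho ho2 => ->; lra.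
have : dot (lin o a d) (lin o a d) = dot (perp (lin o a d)) (perp (lin o a d))
  by rewrite /dot /=; ring.
by rewrite hp dot_lin // /dot !coordE !mul0r addr0 => h; rewrite /dot h ltxx in dd.
Qed.

Lemma crease_point_fold q e d o a b a' b' : 0 < e -> d <> 0 -> orth o a -> orth (- o) a' ->
  (forall x, enorm (x - q) < e -> 0 <= cross d (x - q) -> phi x = rigid o a b x) ->
  (forall x, enorm (x - q) < e -> cross d (x - q) <= 0 -> phi x = rigid (- o) a' b' x) ->
  forall x, enorm (x - q) < e ->
  [/\ 0 < cross d (x - q) -> germ phi x o a b,
      cross d (x - q) < 0 -> germ phi x (- o) a' b' &
      cross d (x - q) = 0 -> crease_point phi x].
Proof.
move=> e0 d0 oa oa' up low.
have pos x : enorm (x - q) < e -> 0 < cross d (x - q) -> germ phi x o a b.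
  move=> xe c0; have [e1 e10 he] := cross_stable (lt0r_neq0 c0).
  exists (Num.min e1 (e - enorm (x - q))); first by rewrite lt_min e10 subr_gt0.
  move=> y; rewrite lt_min => /andP[/he y1 y2]; apply: up.
    by have := enorm_triangle y x q; lra.
  by move: y1; rewrite pmulr_lgt0 // => /ltW.
have neg x : enorm (x - q) < e -> cross d (x - q) < 0 -> germ phi x (- o) a' b'.
  move=> xe c0; have [e1 e10 he] := cross_stable (ltr0_neq0 c0).
  exists (Num.min e1 (e - enorm (x - q))); first by rewrite lt_min e10 subr_gt0.
  move=> y; rewrite lt_min => /andP[/he y1 y2]; apply: low.
    by have := enorm_triangle y x q; lra.
  by move: y1; rewrite nmulr_lgt0 // => /ltW.
move=> x xe; split; [exact: pos | exact: neg | move=> c0].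
pose e' := e - enorm (x - q); have e'0 : 0 < e' by rewrite subr_gt0.
have inb y : enorm (y - x) < e' -> enorm (y - q) < e.
  by rewrite /e' => h; have := enorm_triangle y x q; lra.
have on : o <> - o by have [[->|->] _] := oa => h; lra.
have cN v s : cross d (x + s *: v - q) = s * cross d v.
  by rewrite -[RHS]addr0 -c0 /cross !coordE; ring.
have cp : cross d (perp d) = dot d d by rewrite /cross /dot /=; ring.
split.
(* A germ at [x] would reach both sides of the line and have both orientations. *)
- move=> /unfolded_germ[ o1 [a1 [b1 [oa1 /germ_open[e1 e10 g1]]]]].
  have [s s0 hs] : exists2 s : R, 0 < s & enorm (s *: perp d) < Num.min e1 e'.
    have m0 : 0 < Num.min e1 e' by rewrite lt_min e10.
    have [c c00 hc] := small_step (enorm_ge0 (perp d)) m0.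
    by exists (c / 2); first (by lra); rewrite enormZ; apply: hc; rewrite gtr0_norm; lra.
  have xs v : x + v - x = v by rewrite addrC addKr.
  have [h1 h2] : enorm (x + s *: perp d - x) < e1 /\ enorm (x + s *: perp d - x) < e'.
    by move: hs; rewrite xs lt_min => /andP.
  have [h3 h4] : enorm (x + (- s) *: perp d - x) < e1 /\ enorm (x + (- s) *: perp d - x) < e'.
    by move: hs; rewrite xs scaleNr enormN lt_min => /andP.
  have dd := dot_gt0 d0.
  have k1 := pos _ (inb _ h2); rewrite cN cp in k1; have {}k1 := k1 (mulr_gt0 s0 dd).
  have k2 := neg _ (inb _ h4); rewrite cN cp mulNr oppr_lt0 in k2; have {}k2 := k2 (mulr_gt0 s0 dd).
  have [E1 _ _] := germ_unique oa1 (g1 _ h1) k1.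
  have [E2 _ _] := germ_unique oa1 (g1 _ h3) k2.
  by apply: on; rewrite -E2 E1.
- exists [set y | enorm (y - x) < e'], [set y | enorm (y - x) < e' /\ 0 <= cross d (y - q)],
    [set y | enorm (y - x) < e' /\ cross d (y - q) <= 0], (rigid o a b), (rigid (- o) a' b').
  split.
  + by apply/nbhs_enorm; exists e'.
  + apply/seteqP; split=> y /=; last by case=> [[]|[]].
    by move=> ye; have [h|h] := leP 0 (cross d (y - q)); [left | right; split; rewrite // ltW].
  + by rewrite /= subrr enorm0 c0.
  + split; split; [exact: rigid_isometry | | exact: rigid_isometry |].
      by move=> y [/inb ye]; apply: up.
    by move=> y [/inb ye]; apply: low.
  + move=> fg; have fg' y : enorm (y - x) < 1 -> rigid o a b y = rigid (- o) a' b' y by rewrite fg.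
    by have [] := rigid_unique ltr01 oa fg'.
Qed.

(** With equal orientations the two isometries would agree at [q] only, and one of them would
    prevail on the whole punctured disc, unfolding [q]. With opposite orientations they agree along
    an axis, and [phi] follows one of them on each side. *)
Lemma crease_structure q : crease_point phi q ->
  exists e d o a b a' b', [/\ 0 < e, d <> 0, orth o a, orth (- o) a' &
    forall x, enorm (x - q) < e ->
    [/\ 0 < cross d (x - q) -> germ phi x o a b,
        cross d (x - q) < 0 -> germ phi x (- o) a' b' &
        cross d (x - q) = 0 -> crease_point phi x]].
Proof.
move=> [nunf [N [A [B [f [g [/nbhs_enorm[e e0 he] NE [Aq Bq] [[fiso fA] [giso gB]] fneqg]]]]]]].
have sT : nbhs q (setT : set (R * R)) by apply/nbhs_enorm; exists 1.
have [ o [a [b [oa fE]]]] := isometry_rigid sT fiso.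
have [ o' [a' [b' [oa' gE]]]] := isometry_rigid sT giso.
have alt x : enorm (x - q) < e -> phi x = rigid o a b x \/ phi x = rigid o' a' b' x.
  by move=> /he; rewrite NE => -[/fA ->|/gB ->]; [left; apply: fE | right; apply: gE].
have fgq : rigid o a b q = rigid o' a' b' q by rewrite -fE // -gE // -fA // gB.
have phiq : phi q = rigid o a b q by rewrite -fE // fA.
have notf : ~ (forall x, enorm (x - q) < e -> phi x = rigid o a b x).
  by move=> h; apply: nunf; apply/unfolded_germ; exists o, a, b; split=> //; exists e.
have notg : ~ (forall x, enorm (x - q) < e -> phi x = rigid o' a' b' x).
  by move=> h; apply: nunf; apply/unfolded_germ; exists o', a', b'; split=> //; exists e.
have linE x : rigid o a b x = rigid o' a' b' x <-> lin o a (x - q) = lin o' a' (x - q).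
  rewrite -(rigidB o a b) -(rigidB o' a' b') fgq; split=> [-> //|/eqP].
  by rewrite (can_eq (addrNK _)) => /eqP.
have ho' : o' = o \/ o' = - o.
  have [[[->|->] _] [[->|->] _]] := (oa, oa'); rewrite ?opprK; [by left|by right|by right|by left].
case: ho' => ho'; subst o'.
  exfalso.
  have neq x : x <> q -> rigid o a b x <> rigid o a' b' x.
    move=> xq /linE h.
    have X0 : x - q <> 0 by move/eqP; rewrite subr_eq0 => /eqP.
    have dd := dot_gt0 X0.
    have [ho _] := oa; have osq : o * o = 1 by case: ho => ->; ring.
    have h1 := congr1 fst h; have h2 := congr1 snd h; rewrite /= in h1 h2.
    have aE : a = a'.
      (* For equal orientations the difference of the linear parts is a similarity of ratio
         [enorm (a - a')]. *)
      have : dot (a - a') (a - a') * dot (x - q) (x - q) = 0.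
        transitivity (((a.1 - a'.1) * (x - q).1 - o * (a.2 - a'.2) * (x - q).2) ^+ 2
           + ((a.2 - a'.2) * (x - q).1 + o * (a.1 - a'.1) * (x - q).2) ^+ 2
           + (1 - o * o) * ((a.1 - a'.1) ^+ 2 + (a.2 - a'.2) ^+ 2) * (x - q).2 ^+ 2).
          by rewrite /dot !coordE; ring.
        rewrite osq subrr !mul0r addr0.
        have -> : (a.1 - a'.1) * (x - q).1 - o * (a.2 - a'.2) * (x - q).2 = 0.
          by rewrite /=; move: h1; lra.
        have -> : (a.2 - a'.2) * (x - q).1 + o * (a.1 - a'.1) * (x - q).2 = 0.
          by rewrite /=; move: h2; lra.
        by rewrite expr0n addr0.
      move=> /eqP; rewrite mulf_eq0 (gt_eqF dd) orbF => /eqP /dot_eq0 /eqP.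
      by rewrite subr_eq0 => /eqP.
    apply: fneqg; apply/funext => y; rewrite fE // gE // /rigid aE; congr (_ + _).
    by move: fgq; rewrite /rigid aE => /addIr.
  pose y := q + (e / 2) *: ((1, 0) : R * R).
  have yq : enorm (y - q) = e / 2.
    rewrite /y addrC addKr enormZ gtr0_norm; last by lra.
    by rewrite /enorm /= expr1n expr0n /= addr0 sqrtr1 mulr1.
  have yb : 0 < enorm (y - q) < e by rewrite yq; apply/andP; split; lra.
  have [fy|gy] : phi y = rigid o a b y \/ phi y = rigid o a' b' y by apply: alt; case/andP: yb.
    apply: notf => x xe; have [->//|xq] := pselect (x = q).
    by apply: (rigid_alternative_punctured e0 oa oa' alt neq) => //; exists y.
  apply: notg => x xe; have [->|xq] := pselect (x = q); first by rewrite phiq.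
  have alt' z : enorm (z - q) < e -> phi z = rigid o a' b' z \/ phi z = rigid o a b z.
    by move=> ze; case: (alt z ze); [right | left].
  have neq' z : z <> q -> rigid o a' b' z <> rigid o a b z by move=> zq h; apply: (neq z zq).
  by apply: (rigid_alternative_punctured e0 oa' oa alt' neq') => //; exists y.
have [d d0 hd] := common_axis oa oa'.
have line x : cross d (x - q) = 0 -> rigid o a b x = rigid (- o) a' b' x.
  move=> c0; apply/linE.
  have E : x - q = (dot d (x - q) / dot d d) *: d.
    have dd := dot_gt0 d0; have dV : dot d d / dot d d = 1 by rewrite mulfV // gt_eqF.
    rewrite -[LHS]scale1r -dV -mulrC -[in RHS]mulrC -!scalerA; congr (_ *: _).
    move: c0; move: (x - q) => v; rewrite /cross /dot => c0.
    apply: pair_eq; rewrite !coordE.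
      transitivity ((d.1 * v.1 + d.2 * v.2) * d.1 - d.2 * (d.1 * v.2 - d.2 * v.1)); first by ring.
      by rewrite c0; ring.
    transitivity ((d.1 * v.1 + d.2 * v.2) * d.2 + d.1 * (d.1 * v.2 - d.2 * v.1)); first by ring.
    by rewrite c0; ring.
  by rewrite E !linZ hd.
have off x : cross d (x - q) <> 0 -> rigid o a b x <> rigid (- o) a' b' x.
  by move=> c0 /linE h; apply: c0; apply: lin_off_axis hd h.
have crN v : cross (- d) v = - cross d v by rewrite /cross !coordE; ring.
have linephi x : enorm (x - q) < e -> cross d (x - q) = 0 ->
  phi x = rigid o a b x /\ phi x = rigid (- o) a' b' x.
  by move=> xe c0; have := line x c0; case: (alt x xe) => -> ->.
have offp x : 0 < cross d (x - q) -> rigid o a b x <> rigid (- o) a' b' x.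
  by move=> c; apply: off => h; rewrite h ltxx in c.
have offn x : 0 < cross (- d) (x - q) -> rigid o a b x <> rigid (- o) a' b' x.
  by rewrite crN => c; apply: off => h; rewrite h oppr0 ltxx in c.
have U := rigid_half e0 oa oa' alt offp; have L := rigid_half e0 oa oa' alt offn.
(* The same isometry on both sides would unfold [q]; the two mixed cases differ by exchanging the
   isometries. *)
case: U => U; case: L => L.
- exfalso; apply: notf => x xe; have [c|c|c] := ltgtP (cross d (x - q)) 0.
  + by apply: L; rewrite // crN oppr_gt0.
  + exact: U.
  + by have [] := linephi x xe c.
- exists e, d, o, a, b, a', b'; split=> //; apply: crease_point_fold => // x xe;
    rewrite le_eqVlt => /orP[/eqP c|c].
  + by have [] := linephi x xe (esym c).
  + exact: U.
  + by have [] := linephi x xe c.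
  + by apply: L; rewrite // crN oppr_gt0.
- have oa2 : orth (- - o) a by rewrite opprK.
  exists e, d, (- o), a', b', a, b; split=> //; apply: crease_point_fold => // x xe;
    rewrite le_eqVlt => /orP[/eqP c|c].
  + by have [] := linephi x xe (esym c).
  + exact: U.
  + by rewrite opprK; have [] := linephi x xe c.
  + by rewrite opprK; apply: L; rewrite // crN oppr_gt0.
- exfalso; apply: notg => x xe; have [c|c|c] := ltgtP (cross d (x - q)) 0.
  + by apply: L; rewrite // crN oppr_gt0.
  + exact: U.
  + by have [] := linephi x xe c.
Qed.
End Crease.

(** * Edges *)

Section Edges.
Variable R : realType.
Implicit Types (x y z u v w p q d : R * R) (s t k r e : R) (b : bool) (f : set (R * R)).
Variable phi : R * R -> R * R.
Hypothesis fold : local_flat_folding phi.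

Lemma crease_not_vertex x : crease_point phi x -> ~ vertex_point phi x.
Proof. by move=> c [_ nc _]; apply: nc. Qed.

Lemma crease_line q : crease_point phi q -> exists (e : R) d, [/\ 0 < e, d <> 0 &
  forall x, enorm (x - q) < e -> (crease_point phi x <-> cross d (x - q) = 0)].
Proof.
move=> /(crease_structure (folding_radial fold)) [e [d [ o [a [b [a' [b' [e0 d0 oa oa' h]]]]]]]].
exists e, d; split=> // x xe; have [h1 h2 h3] := h x xe; split=> // -[nu _].
have [c|c|//] := ltgtP (cross d (x - q)) 0; exfalso; apply: nu; apply/unfolded_germ.
  by exists (- o), a', b'; split=> //; apply: h2.
by exists o, a, b; split=> //; apply: h1.
Qed.

(** One crease point [q + s *: v] close enough to [q], with [s] nonzero, puts [v] along the crease
    line. *)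
Lemma crease_line_along q v : crease_point phi q ->
  (forall e : R, 0 < e -> exists2 s : R, 0 < `|s| < e & crease_point phi (q + s *: v)) ->
  exists2 e : R, 0 < e & forall s, `|s| < e -> crease_point phi (q + s *: v).
Proof.
move=> /crease_line[e [d [e0 d0 h]]] near.
have qs w : q + w - q = w by rewrite addrC addKr.
have [r r0 hr] := small_step (enorm_ge0 v) e0.
have cZ s : cross d (s *: v) = s * cross d v by rewrite /cross !coordE; ring.
exists r => // s sr; apply/h; rewrite qs ?enormZ; first exact: hr.
have [s' /andP[s0 s'r]] := near r r0.
rewrite h qs ?enormZ; last exact: hr.
rewrite !cZ => /eqP; rewrite mulf_eq0 -normr_eq0 (gt_eqF s0) => /eqP ->.
by rewrite mulr0.
Qed.

(* The open segment from p to p + v, or the open ray from p in the direction v if b. *)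
Definition stub p v (b : bool) : set (R * R) :=
  [set x | exists2 k : R, 0 < k /\ (b \/ k < 1) & x = p + k *: v].

(** An edge seen from one of its ends, segments and rays at once. For a ray, [v] is determined only
    up to a positive factor. *)
Definition stub_edge p v (b : bool) f :=
  [/\ vertex_point phi p, v <> 0, f = stub p v b, f `<=` crease_point phi &
      (b = false -> vertex_point phi (p + v))].

Lemma open_segment_stub p q : open_segment p q = stub p (q - p) false.
Proof.
apply/seteqP; split=> x /=.
  by move=> [t /andP[t0 t1] <-]; exists t => //; split=> //; right.
by move=> [t [t0 [//|t1]] ->]; exists t => //=; rewrite t0.
Qed.

Lemma open_ray_stub p d : open_ray p d = stub p d true.
Proof.
apply/seteqP; split=> x /=; first by move=> [t t0 <-]; exists t => //; split=> //; left.
by move=> [t [t0 _] ->]; exists t.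
Qed.

Definition far_end p v (b : bool) : option (R * R) := if b then None else Some (p + v).

Lemma stub_edge_joins p v b f : stub_edge p v b f ->
  folding_joins phi f (Some p) (far_end p v b).
Proof.
case: b => -[vp v0 fE cr h]; rewrite /=.
  by split=> //; exists v; split=> //; rewrite open_ray_stub.
split=> //; first exact: h.
  by move=> /(congr1 (fun x => x - p)); rewrite subrr addrC addKr => /esym.
by rewrite open_segment_stub [p + v]addrC addrK.
Qed.

Lemma joins_stub_edge p (w : option (R * R)) f : folding_joins phi f (Some p) w ->
  exists v b, stub_edge p v b f /\ w = far_end p v b.
Proof.
case: w => [q|] /=.
  move=> [vp vq pq fE cr]; exists (q - p), false; split; last by rewrite /= addrC subrK.
  split=> //; first by move/eqP; rewrite subr_eq0 => /eqP /esym.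
    by rewrite -open_segment_stub.
  by rewrite addrC subrK.
move=> [vp [d [d0 fE cr]]]; exists d, true; split=> //; split=> //.
by rewrite -open_ray_stub.
Qed.

Lemma stub_rev p v : stub p v false = stub (p + v) (- v) false.
Proof.
apply/seteqP; split=> x /= [k [k0 [//|k1]] ->]; exists (1 - k).
- by split; [rewrite subr_gt0 | right; lra].
- by apply: pair_eq; rewrite !coordE; ring.
- by split; [rewrite subr_gt0 | right; lra].
- by apply: pair_eq; rewrite !coordE; ring.
Qed.

Lemma stub_edge_rev p v f : stub_edge p v false f -> stub_edge (p + v) (- v) false f.
Proof.
move=> [vp v0 fE cr h]; split=> //; first exact: h.
- by move/eqP; rewrite oppr_eq0 => /eqP.
- by rewrite fE stub_rev.
- by rewrite addrK.
Qed.

Lemma folding_joins_sym f (u v : option (R * R)) : folding_joins phi f u v ->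
  folding_joins phi f v u.
Proof.
case: u v => [p|] [q|] //= [vp vq pq fE cr]; split=> //; first exact: nesym.
rewrite fE !open_segment_stub stub_rev; congr (stub _ _ false); first by rewrite addrC subrK.
by rewrite opprB.
Qed.

Lemma scale_inj v s t : v <> 0 -> s *: v = t *: v -> s = t.
Proof.
move=> v0 /eqP; rewrite -subr_eq0 -scalerBl scaler_eq0 subr_eq0 => /orP[/eqP //|/eqP] //.
Qed.

Lemma stub_edge_vertex p v b f k : stub_edge p v b f -> vertex_point phi (p + k *: v) ->
  k <= 0 \/ (b = false /\ 1 <= k).
Proof.
move=> [vp v0 fE cr _] vx; have [k0|k0] := leP k 0; first by left.
right; have nf : ~ f (p + k *: v) by move=> /cr/crease_not_vertex; apply.
move: nf; rewrite fE; case: b {fE} => nf.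
  by exfalso; apply: nf; exists k => //; split=> //; left.
split=> //; rewrite leNgt; apply/negP => k1; apply: nf.
by exists k => //; split=> //; right.
Qed.

(** The ends can be recovered from the point set: [x] is a limit of points of [f] but, being a
    vertex point, is not in [f]. *)
Lemma stub_edge_ends p v b f x v' b' : stub_edge p v b f -> stub_edge x v' b' f ->
  x = p \/ (b = false /\ x = p + v).
Proof.
move=> E E'; have [vp v0 fE cr _] := E; have [vx v'0 fE' _ _] := E'.
have F k : 0 < k -> k < 1 -> exists2 j : R, 0 < j /\ (b \/ j < 1) & x + k *: v' = p + j *: v.
  move=> k0 k1; have : f (x + k *: v') by rewrite fE'; exists k => //; split=> //; right.
  by rewrite fE.
(* Two sample points place the second parametrization on the line of the first: [v'] is 4 times
   their difference. *)
have [j1 hj1 e1] := F (1/2) ltac:(lra) ltac:(lra).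
have [j2 hj2 e2] := F (1/4) ltac:(lra) ltac:(lra).
pose c := 4 * (j1 - j2).
have v'E : v' = c *: v.
  have -> : v' = 4 *: ((x + (1 / 2) *: v') - (x + (1 / 4) *: v')).
    by apply: pair_eq; rewrite !coordE; field.
  by rewrite e1 e2 /c; apply: pair_eq; rewrite !coordE; ring.
pose m := j1 - c / 2.
have xE : x = p + m *: v.
  have -> : x = (x + (1 / 2) *: v') - (1 / 2) *: v' by rewrite addrK.
  by rewrite e1 v'E /m; apply: pair_eq; rewrite !coordE; field.
have G k : 0 < k -> k < 1 -> 0 < m + k * c /\ (b \/ m + k * c < 1).
  move=> k0 k1; have [j hj] := F k k0 k1.
  rewrite xE v'E scalerA -addrA -scalerDl => /addrI /(scale_inj v0) -> //.
have mv : vertex_point phi (p + m *: v) by rewrite -xE.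
have small (n : R) : 0 < n -> exists2 k : R, 0 < k < 1 & `|k * c| < n.
  move=> n0; have [d d0 hd] := small_step (normr_ge0 c) n0.
  pose k := Num.min (d / 2) (1 / 2).
  have k0 : 0 < k by rewrite lt_min; apply/andP; split; lra.
  have kd : k <= d / 2 by rewrite ge_min lexx.
  have k1 : k <= 1 / 2 by rewrite ge_min lexx orbT.
  exists k; first by apply/andP; split; lra.
  by rewrite normrM; apply: hd; rewrite gtr0_norm; lra.
have [m0|[bf m1]] := stub_edge_vertex E mv.
  left; rewrite xE; suff -> : m = 0 by rewrite scale0r addr0.
  apply/eqP; rewrite eq_le m0 leNgt; apply/negP => mneg.
  have [k /andP[k0 k1] kc] := small (- m) ltac:(lra).
  have [h _] := G k k0 k1; move: kc; rewrite ltr_norml => /andP[_]; lra.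
right; split=> //; rewrite xE; suff -> : m = 1 by rewrite scale1r.
apply/eqP; rewrite eq_le m1 andbT leNgt; apply/negP => mgt.
have [k /andP[k0 k1] kc] := small (m - 1) ltac:(lra).
have [_ [h|h]] := G k k0 k1; first by rewrite bf in h.
move: kc; rewrite ltr_norml => /andP[h' _]; exfalso; clear - h h'; lra.
Qed.

(** If one went beyond the other, the vertex point ending the shorter would be inside the longer,
    which has only crease points. *)
Lemma stub_edge_same_direction p v b f c b' f' : 0 < c ->
  stub_edge p v b f -> stub_edge p (c *: v) b' f' -> f = f'.
Proof.
move=> c0 E E'; have [_ v0 fE _ h] := E; have [_ _ fE' _ h'] := E'.
have H : b' = false -> b = false /\ 1 <= c.
  move=> /h' vx; have [k0|//] := stub_edge_vertex E vx; lra.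
have H' : b = false -> b' = false /\ c <= 1.
  move=> /h vx; have cV : c^-1 * c = 1 by rewrite mulVf // gt_eqF.
  have vx' : vertex_point phi (p + c^-1 *: (c *: v)) by rewrite scalerA cV scale1r.
  have ci : 0 < c^-1 by rewrite invr_gt0.
  have [k0|[-> k1]] := stub_edge_vertex E' vx'; first lra.
  by split=> //; move: k1; rewrite -(ler_pM2l c0) mulr1 mulfV // gt_eqF.
rewrite fE fE'; case: b b' H H' {E E' fE fE' h h'} => [] [] H H'.
- apply/seteqP; split=> x [k [k0 _] ->].
    exists (k / c); first by split; [exact: divr_gt0 | left].
    by rewrite scalerA divfK // gt_eqF.
  exists (k * c); first by split; [exact: mulr_gt0 | left].
  by rewrite scalerA.
- by have [] := H erefl.
- by have [] := H' erefl.
- have -> : c = 1 by have [_ ?] := H erefl; have [_ ?] := H' erefl; lra.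
  by rewrite scale1r.
Qed.

Lemma stub_edge_direction p v b f v' b' : stub_edge p v b f -> stub_edge p v' b' f ->
  exists2 c : R, 0 < c & v' = c *: v.
Proof.
move=> [_ _ fE _ _] [_ _ fE' _ _].
have : f (p + (1 / 2) *: v').
  by rewrite fE'; exists (1 / 2) => //; split; [lra | right; lra].
rewrite fE => -[k [k0 _] /addrI h]; exists (2 * k); first by lra.
by rewrite -scalerA -h scalerA; have -> : 2 * (1 / 2) = 1 :> R by [field]; rewrite scale1r.
Qed.

(** Near [z] the crease points form one line, so the two edges are collinear; as no edge contains a
    vertex point, they must then share an end and leave it in the same direction. *)
Lemma stub_edge_inter p v b f p' v' b' f' z :
  stub_edge p v b f -> stub_edge p' v' b' f' -> f z -> f' z -> f = f'.
Proof.
move=> E E' fz f'z; have [vp v0 fE cr h] := E; have [vp' v'0 fE' cr' h'] := E'.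
have [e [d [e0 d0 line]]] := crease_line (cr z fz).
(* A small step from [z] back towards [P] stays on the edge, for a ray as for a segment. *)
have par P V B F : F = stub P V B -> F z -> F `<=` crease_point phi -> cross d V = 0.
  move=> -> [k [k0 kb] zE] Fcr.
  have m0 : 0 < Num.min e k by rewrite lt_min e0.
  have [r r0 hr] := small_step (enorm_ge0 V) m0.
  pose s := Num.min (r / 2) (k / 2).
  have s0 : 0 < s by rewrite lt_min; apply/andP; split; lra.
  have sr : s <= r / 2 by rewrite ge_min lexx.
  have sk : s <= k / 2 by rewrite ge_min lexx orbT.
  have zs : z + (- s) *: V - z = (- s) *: V by rewrite addrC addKr.
  have : enorm (z + (- s) *: V - z) < Num.min e k.
    by rewrite zs enormZ normrN; apply: hr; rewrite gtr0_norm; lra.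
  rewrite lt_min => /andP[/line zl _].
  have : crease_point phi (z + (- s) *: V).
    apply: Fcr; exists (k - s); last by rewrite zE; apply: pair_eq; rewrite !coordE; ring.
    by split; [lra | case: kb; [left | right; lra]].
  rewrite zl zs; have -> : cross d (- s *: V) = - s * cross d V by rewrite /cross !coordE; ring.
  by move=> /eqP; rewrite mulf_eq0 oppr_eq0 (gt_eqF s0) => /eqP.
have c1 := par _ _ _ _ fE fz cr; have c2 := par _ _ _ _ fE' f'z cr'.
have [c v'E] : exists c : R, v' = c *: v.
  exists (dot v' v / dot v v); have vv := dot_gt0 v0; have dd := dot_gt0 d0.
  have cvv : cross v' v = 0.
    have : dot d d * cross v' v = dot d v' * cross d v - dot d v * cross d v'.
      by rewrite /dot /cross; ring.
    by rewrite c1 c2 !mulr0 subrr => /eqP; rewrite mulf_eq0 (gt_eqF dd) => /eqP.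
  have vV : dot v v / dot v v = 1 by rewrite mulfV // gt_eqF.
  rewrite -[LHS]scale1r -vV mulrC -[in RHS]mulrC -!scalerA; congr (_ *: _).
  move: cvv; rewrite /dot /cross => cvv; apply: pair_eq; rewrite !coordE.
    transitivity ((v'.1 * v.1 + v'.2 * v.2) * v.1 + v.2 * (v'.1 * v.2 - v'.2 * v.1)); first by ring.
    by rewrite cvv; ring.
  transitivity ((v'.1 * v.1 + v'.2 * v.2) * v.2 - v.1 * (v'.1 * v.2 - v'.2 * v.1)); first by ring.
  by rewrite cvv; ring.
have [k [k0 kb] zE] : stub p v b z by rewrite -fE.
have [j [j0 jb] zE'] : stub p' v' b' z by rewrite -fE'.
have p'E : p' = p + (k - j * c) *: v.
  have -> : p' = z - j *: v' by rewrite zE' addrK.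
  by rewrite zE v'E; apply: pair_eq; rewrite !coordE; ring.
have cN0 : c != 0 by apply/eqP => c0; apply: v'0; rewrite v'E c0 scale0r.
set m := k - j * c in p'E.
have vm : vertex_point phi (p + m *: v) by rewrite -p'E.
have pE : p = p' + (- m / c) *: v'.
  by rewrite p'E v'E; apply: pair_eq; rewrite !coordE; field.
have := vp; rewrite {1}pE => /(stub_edge_vertex E') h0.
(* Equal directions will give [p' = p]; opposite directions will give [p' = p + v], and the first
   edge is then reversed. *)
have [cpos|cneg] : 0 < c \/ c < 0 by move: cN0; rewrite neq_lt => /orP[]; [right|left].
  have jc : 0 < j * c by apply: mulr_gt0.
  have m0 : m = 0.
    have [m0|[bf m1]] := stub_edge_vertex E vm; last first.
      by exfalso; case: kb; [rewrite bf | rewrite /m in m1; lra].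
    have [n0|[b'f n1]] := h0.
      by move: n0; rewrite pmulr_lle0 ?invr_gt0 //; lra.
    case: jb => [|j1]; first by rewrite b'f.
    by move: n1; rewrite ler_pdivlMr // mul1r /m => n1; exfalso; have : j * c < c
      by [rewrite gtr_pMl]; lra.
  have pp : p' = p by rewrite p'E m0 scale0r addr0.
  rewrite pp v'E in E'. exact: stub_edge_same_direction cpos E E'.
have jc : 0 < j * - c by apply: mulr_gt0 => //; lra.
have mk : k < m by rewrite /m; lra.
have [m0|[bf m1]] := stub_edge_vertex E vm; first by exfalso; clear - m0 mk k0; lra.
have m1' : m = 1.
  rewrite bf in E; have Er := stub_edge_rev E; have [vr _ _ _ _] := Er.
  have pvE : p + v = p' + ((1 - m) / c) *: v'.
    by rewrite p'E v'E; apply: pair_eq; rewrite !coordE; field.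
  have := vr; rewrite pvE => /(stub_edge_vertex E') [n0|[b'f n1]].
    by move: n0; rewrite nmulr_lle0 ?invr_lt0 //; lra.
  case: jb => [|j1]; first by rewrite b'f.
  move: n1; rewrite ler_ndivlMr // mul1r => n1; case: kb => [|k1]; first by rewrite bf.
  have : j * - c < - c by rewrite gtr_pMl //; lra.
  by rewrite /m in n1 => h1; exfalso; clear - n1 h1 k1; lra.
rewrite bf in E; have Er := stub_edge_rev E.
have pp : p' = p + v by rewrite p'E m1' scale1r.
have v'N : v' = (- c) *: (- v) by rewrite scaleNr scalerN opprK.
rewrite pp v'N in E'; have cN : 0 < - c by rewrite oppr_gt0.
exact: stub_edge_same_direction cN Er E'.
Qed.

End Edges.

(** * Edges at a vertex point *)

Section VertexEdges.
Variable R : realType.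
Implicit Types (x y z u v w p q d : R * R) (s t k r e : R) (b : bool) (f : set (R * R)).
Variable phi : R * R -> R * R.
Hypothesis fold : local_flat_folding phi.
Hypothesis fin_vertices : finite_set (vertex_point phi).

Lemma seq_argmin (T : eqType) (F : T -> R) (l : seq T) : l != [::] ->
  exists2 i, i \in l & forall j, j \in l -> F i <= F j.
Proof.
elim: l => [//|a l IH] _; have [->|sn] := eqVneq l [::].
  by exists a; rewrite ?mem_head // => y; rewrite mem_seq1 => /eqP ->.
have [x xs hx] := IH sn; have [ax|xa] := leP (F a) (F x).
  exists a; first exact: mem_head.
  by move=> y; rewrite inE => /orP[/eqP -> //|/hx]; apply: le_trans.
exists x; first by rewrite inE xs orbT.
by move=> y; rewrite inE => /orP[/eqP ->|/hx //]; apply: ltW.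
Qed.

Lemma finite_argmin (T : choiceType) (A : set T) (F : T -> R) : finite_set A -> A !=set0 ->
  exists2 i, A i & forall j, A j -> F i <= F j.
Proof.
move=> /finite_seqP[s ->] [x0 /= x0s]; have : s != [::] by case: s x0s.
by move=> /(seq_argmin F)[x xs hx]; exists x.
Qed.

Lemma vertex_isolated p : exists2 e : R, 0 < e &
  forall x, x <> p -> enorm (x - p) < e -> ~ vertex_point phi x.
Proof.
have [[x0 hx0]|none] := pselect ((vertex_point phi `&` [set x | x <> p]) !=set0); last first.
  by exists 1 => // x xp _ vx; apply: none; exists x.
have fin : finite_set (vertex_point phi `&` [set x | x <> p]) by apply: finite_setIl.
have [x [vx xp] hx] := finite_argmin (fun x => enorm (x - p)) fin (ex_intro _ x0 hx0).
exists (enorm (x - p)).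
  by apply: enorm_gt0 => /eqP; rewrite subr_eq0 => /eqP.
by move=> y yp yx vy; have := hx y (conj vy yp); rewrite leNgt yx.
Qed.

Lemma crease_not_unfolded x : crease_point phi x -> ~ unfolded_point phi x.
Proof. by case. Qed.

(** Real induction: past a crease point the crease goes on along its line, and a limit of crease
    points is not unfolded, unfolded points forming an open set. *)
Lemma crease_ray_continues p v r : v <> 0 -> 1 <= r ->
  (forall t, 0 < t <= 1 -> crease_point phi (p + t *: v)) ->
  (forall t, 0 < t <= r -> ~ vertex_point phi (p + t *: v)) ->
  crease_point phi (p + r *: v).
Proof.
move=> v0 r1 cr nv; have [_ types _] := fold.
have shift t s : p + t *: v + s *: v = p + (t + s) *: v by rewrite scalerDl addrA.
have n0 := enorm_ge0 v.
have cr' P t : (forall s, 1 <= s <= t -> P s : Prop) -> (forall s, 0 < s <= 1 -> P s) ->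
    forall s, 0 < s <= t -> P s.
  move=> h1 h2 s /andP[s0 st]; have [s1|s1] := leP s 1; first by apply: h2; rewrite s0.
  by apply: h1; rewrite st andbT ltW.
apply: (@real_induction R (fun t => crease_point phi (p + t *: v)) 1 r); last by rewrite r1 lexx.
- by apply: cr; rewrite ltr01 lexx.
- move=> t /andP[t1 tr] h; have h' := cr' _ _ h cr.
  have near e : 0 < e -> exists2 s : R, 0 < `|s| < e & crease_point phi (p + t *: v + s *: v).
    move=> e0; pose m := Num.min (e / 2) (1 / 2).
    have m0 : 0 < m by rewrite lt_min; apply/andP; split; lra.
    have md : m <= e / 2 by rewrite ge_min lexx.
    have m1 : m <= 1 / 2 by rewrite ge_min lexx orbT.
    exists (- m); first by rewrite normrN gtr0_norm // m0 /=; lra.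
    by rewrite shift; apply: h'; apply/andP; split; lra.
  have ct : crease_point phi (p + t *: v) by apply: h'; rewrite lexx andbT; lra.
  have [e e0 he] := crease_line_along fold ct near.
  exists e => // s /andP[ts se]; have -> : s = t + (s - t) by rewrite addrC subrK.
  by rewrite -shift; apply: he; rewrite gtr0_norm ?subr_gt0 //; lra.
- move=> t /andP[t1 tr] h; have t0 : 0 < t by lra.
  case: (types (p + t *: v)) => [/unfolded_open[e e0 he]| //|vt]; last first.
    by exfalso; apply: (nv t); rewrite ?t0.
  exfalso; have [s /andP[s0 st] sd] := small_step01 n0 e0 t0.
  (* [s] may be 0, which is the apex [p]; the maximum is positive and still close to [t]. *)
  pose s' := Num.max s (t / 2).
  have s't : s' < t by rewrite gt_max st /=; lra.
  have s'0 : 0 < s' by rewrite lt_max; apply/orP; right; lra.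
  have ss' : s <= s' by rewrite le_max lexx.
  have c : crease_point phi (p + s' *: v).
    have [s1|s1] := leP s' 1; first by apply: cr; rewrite s'0.
    by apply: h; rewrite s't andbT ltW.
  apply: (crease_not_unfolded c); apply: he.
  have -> : p + s' *: v - (p + t *: v) = (s' - t) *: v by apply: pair_eq; rewrite !coordE; ring.
  rewrite enormZ; apply: le_lt_trans sd; rewrite ler_wpM2r //.
  by rewrite !ltr0_norm ?subr_lt0 //; lra.
Qed.

(** The crease is prolonged up to the first vertex point on the ray, which finiteness provides if
    the ray meets any. *)
Lemma stub_edge_extend p v : vertex_point phi p -> v <> 0 ->
  (forall t, 0 < t <= 1 -> crease_point phi (p + t *: v)) ->
  exists f c b, 0 < c /\ stub_edge phi p (c *: v) b f.
Proof.
move=> vp v0 cr.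
pose A := vertex_point phi `&` [set x | exists2 t : R, 0 < t & x = p + t *: v].
have [[x0 hx0]|none] := pselect (A !=set0); last first.
  exists (stub p v true), 1, true; split=> //; rewrite scale1r; split=> //.
  move=> x [t [t0 _] ->]; have [t1|t1] := leP t 1; first by apply: cr; rewrite t0.
  apply: crease_ray_continues => //; first exact: ltW.
  by move=> s /andP[s0 _] vs; apply: none; exists (p + s *: v); split=> //; exists s.
have fin : finite_set A by apply: finite_setIl.
have [x [vx [c c0 xE]] hx] := finite_argmin (fun x => enorm (x - p)) fin (ex_intro _ x0 hx0).
have before t : 0 < t -> t < c -> ~ vertex_point phi (p + t *: v).
  move=> t0 tc vt; have := hx _ (conj vt (ex_intro2 _ _ t t0 erefl)).
  rewrite xE ![p + _]addrC !addrK !enormZ !gtr0_norm // leNgt ltr_pM2r ?enorm_gt0 //.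
  by rewrite tc.
exists (stub p (c *: v) false), c, false; split=> //; split=> //.
- by move=> /eqP; rewrite scaler_eq0 (gt_eqF c0) => /eqP.
- move=> y [k [k0 [//|k1]] ->]; rewrite scalerA.
  have kc0 : 0 < k * c by apply: mulr_gt0.
  have kc : k * c < c by rewrite gtr_pMl.
  have [t1|t1] := leP (k * c) 1; first by apply: cr; rewrite kc0.
  apply: crease_ray_continues => //; first exact: ltW.
  by move=> s /andP[s0 sk]; apply: before => //; apply: le_lt_trans kc.
- by rewrite -xE.
Qed.

(** In a ball without other vertex points a crease point is one that is not unfolded, and
    [germ_homogeneous] moves unfolded points along rays from [p]. *)
Lemma vertex_neighborhood p : vertex_point phi p -> exists e : R, [/\ 0 < e,
  (forall y, enorm (y - p) < e -> enorm (phi y - phi p) = enorm (y - p)),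
  (forall x, x <> p -> enorm (x - p) < e -> unfolded_point phi x \/ crease_point phi x) &
  (forall x t, x <> p -> enorm (x - p) < e -> 0 < t <= 1 ->
    (crease_point phi (seg p x t) <-> crease_point phi x))].
Proof.
move=> vp; have [_ types _] := fold; have rad := folding_radial fold.
have [e1 e10 h1] := rad p; have [e2 e20 h2] := vertex_isolated p.
exists (Num.min e1 e2).
have rad1 y : enorm (y - p) < Num.min e1 e2 -> enorm (phi y - phi p) = enorm (y - p).
  by rewrite lt_min => /andP[/h1].
have uc x : x <> p -> enorm (x - p) < Num.min e1 e2 -> unfolded_point phi x \/ crease_point phi x.
  rewrite lt_min => xp /andP[_ xe]; by case: (types x) => [|| /(h2 x xp xe) //]; [left|right].
split=> //; first by rewrite lt_min e10.
move=> x t xp xe t01; have /andP[t0 t1] := t01.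
have sE : seg p x t - p = t *: (x - p) by rewrite /seg addrC addKr.
have sp : seg p x t <> p.
  move=> /eqP; rewrite -subr_eq0 sE scaler_eq0 (gt_eqF t0) subr_eq0 => /eqP.
  exact: xp.
have se : enorm (seg p x t - p) < Num.min e1 e2.
  rewrite sE enormZ gtr0_norm //; apply: le_lt_trans xe.
  by rewrite ler_piMl ?enorm_ge0.
have U : unfolded_point phi x <-> unfolded_point phi (seg p x t).
  split=> /unfolded_germ[ o [a [b [oa g]]]]; apply/unfolded_germ.
    have [w g'] : exists w, germ phi (seg p x t) o a w.
      by apply/(germ_homogeneous rad rad1 _ _ xe t01); exists b.
    by exists o, a, w.
  have [w g'] : exists w, germ phi x o a w.
    by apply/(germ_homogeneous rad rad1 _ _ xe t01); exists b.
  by exists o, a, w.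
split=> [c|c].
  by case: (uc x xp xe) => // /U /(crease_not_unfolded c).
by case: (uc _ sp se) => // /U /(crease_not_unfolded c).
Qed.

Lemma vertex_edge_direction p u : vertex_point phi p -> u <> 0 ->
  exists v b f, stub_edge phi p v b f /\ 0 < dot v u.
Proof.
move=> vp u0; have [e [e0 rad uc hom]] := vertex_neighborhood vp.
have [x [xe xu nu]] := vertex_crease_direction (folding_radial fold) vp u0 e0 rad.
have xp : x <> p by move=> h; rewrite h subrr /dot !coordE !mul0r addr0 ltxx in xu.
have cx : crease_point phi x by case: (uc x xp xe).
have v0 : x - p <> 0 by move=> /eqP; rewrite subr_eq0 => /eqP.
have [|f [c [b [c0 E]]]] := stub_edge_extend vp v0.
  by move=> t t01; apply/(hom x t xp xe t01).
exists (c *: (x - p)), b, f; split=> //.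
have -> : dot (c *: (x - p)) u = c * dot (x - p) u by rewrite /dot !coordE; ring.
exact: mulr_gt0.
Qed.

End VertexEdges.

(** * Parity of the degree of a vertex *)

Section Parity.
Variable R : realType.
Implicit Types (x y z u v w p q d : R * R) (s t k r e : R) (f : set (R * R)).

(** [T] lists the jumps of [sigma]. Its correction [psi] by the parity of the jumps already passed
    is constant off [T]; on [T] nothing can be said, as the local hypothesis leaves the value at a
    jump free. *)
Lemma alternating_parity (T : seq R) (sigma : R -> bool) a b : uniq T ->
  a < b -> a \notin T -> b \notin T ->
  (forall t, exists2 e : R, 0 < e & exists c : bool, forall s, `|s - t| < e ->
    [/\ s < t -> sigma s = c, t < s -> sigma s = c (+) (t \in T),
        s != t -> s \notin T & t \notin T -> s = t -> sigma s = c]) ->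
  sigma b = sigma a (+) odd (count (fun t => a < t < b) T).
Proof.
move=> uT ab aT bT loc.
have xorK (c1 c2 c3 : bool) : (c1 (+) c2) (+) (c3 (+) c2) = c1 (+) c3 by case: c1 c2 c3 => [] [] [].
pose psi t := sigma t (+) odd (count (fun s => a < s < t) T).
have cnt t s : t < s -> (forall k, t < k -> k < s -> k \notin T) -> a < t ->
    count (fun k => a < k < s) T = addn (count (fun k => a < k < t) T) (t \in T).
  move=> ts none at_.
  rewrite -(count_uniq_mem t uT) -count_predUI -[RHS]addn0 (@eq_count _ (predI _ _) pred0).
    rewrite count_pred0 addn0 addn0; apply: eq_in_count => k kT /=.
    have [->|yt] := eqVneq k t; first by rewrite at_ ts orbT.
    rewrite orbF; case: (ltP a k) => //= ay.
    have [yt'|yt'] := ltP k t; first by rewrite (lt_trans yt' ts).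
    apply/negbTE; rewrite -leNgt leNgt; apply/negP => ys.
    by have := none k _ ys; rewrite kT lt_neqAle eq_sym yt yt' => /(_ isT).
  by move=> k /=; case: eqP => [->|]; rewrite ?ltxx ?andbF.
have cnta s : a < s -> (forall k, a < k -> k < s -> k \notin T) -> count (fun k =>
  a < k < s) T = 0%N.
  move=> as_ none; apply/eqP; rewrite -leqn0 leqNgt -has_count; apply/hasPn => k kT.
  by apply/negP => /andP[h1 h2]; have := none k h1 h2; rewrite kT.
suff H : b \notin T -> psi b = sigma a.
  by rewrite -(H bT) /psi -addbA addbb addbF.
apply: (@real_induction R (fun t => t \notin T -> psi t = sigma a) a b); last
  by rewrite (ltW ab) lexx.
- move=> _; rewrite /psi (@eq_count _ _ pred0) ?count_pred0 ?addbF // => k /=.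
  by apply/negbTE/negP => /andP[h1 /(lt_trans h1)]; rewrite ltxx.
- move=> t /andP[at_ tb] h; have [e e0 [c loct]] := loc t.
  exists e => // s /andP[ts se] sT.
  have hs : `|s - t| < e by rewrite gtr0_norm ?subr_gt0 //; lra.
  have [_ /(_ ts) sc _ _] := loct s hs.
  have none k : t < k -> k < s -> k \notin T.
    move=> ty ys; have hy : `|k - t| < e by rewrite gtr0_norm ?subr_gt0 //; lra.
    by have [_ _ h1 _] := loct k hy; apply: h1; rewrite gt_eqF.
  have [aeq|at'] : a = t \/ a < t by move: at_; rewrite le_eqVlt => /orP[/eqP|]; [left|right].
    rewrite /psi sc cnta ?addbF -?aeq //; first last.
    + by rewrite aeq.
    + by rewrite aeq.
    rewrite (negbTE aT) addbF.
    have ht : `|t - t| < e by rewrite subrr normr0.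
    by have [_ _ _ <-] := loct t ht; rewrite -?aeq.
  rewrite /psi sc (cnt t s ts none at') oddD oddb xorK.
  (* A parameter just before [t], after [a], with no jump strictly between it and [t]. *)
  pose m := Num.max (t - e / 2) ((a + t) / 2).
  have mt : m < t by rewrite gt_max; apply/andP; split; lra.
  have me : t - e / 2 <= m by rewrite le_max lexx.
  have ma : (a + t) / 2 <= m by rewrite le_max lexx orbT.
  have hm : `|m - t| < e by rewrite ltr0_norm ?subr_lt0 //; lra.
  have [/(_ mt) mc _ /(_ (negbT (lt_eqF mt))) mT _] := loct m hm.
  have := h m; rewrite (ltW mt) andbT => /(_ _ mT); rewrite /psi mc => <-; last by lra.
  congr (_ (+) odd _); apply: eq_in_count => k kT.
  case: (ltP a k) => //= ay; have [ym|ym] := ltP k m; first by rewrite (lt_trans ym mt).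
  apply/negbTE/negP => yt; have hy : `|k - t| < e by rewrite ltr0_norm ?subr_lt0 //; lra.
  by have [_ _ h1 _] := loct k hy; have := h1 (negbT (lt_eqF yt)); rewrite kT.
- move=> t /andP[at_ tb] h tT; have [e e0 [c loct]] := loc t.
  pose m := Num.max (t - e / 2) ((a + t) / 2).
  have mt : m < t by rewrite gt_max; apply/andP; split; lra.
  have me : t - e / 2 <= m by rewrite le_max lexx.
  have ma : (a + t) / 2 <= m by rewrite le_max lexx orbT.
  have hm : `|m - t| < e by rewrite ltr0_norm ?subr_lt0 //; lra.
  have [/(_ mt) mc _ /(_ (negbT (lt_eqF mt))) mT _] := loct m hm.
  have := h m; rewrite mt andbT => /(_ _ mT); rewrite /psi mc => <-; last by lra.
  have ht : `|t - t| < e by rewrite subrr normr0.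
  have [_ _ _ ->] := loct t ht => //.
  congr (_ (+) odd _); apply: eq_in_count => k kT.
  case: (ltP a k) => //= ay; have [ym|ym] := ltP k m; first by rewrite (lt_trans ym mt).
  apply/negbTE/negP => yt; have hy : `|k - t| < e by rewrite ltr0_norm ?subr_lt0 //; lra.
  by have [_ _ h1 _] := loct k hy; have := h1 (negbT (lt_eqF yt)); rewrite kT.
Qed.

(* The rational parametrization of the circle misses the point - r *: u. *)
Definition circ r u t : R * R := (r / (1 + t ^+ 2)) *: ((1 - t ^+ 2) *: u + (2 * t) *: perp u).

Lemma sqr1_gt0 t : 0 < 1 + t ^+ 2.
Proof. by have := sqr_ge0 t; lra. Qed.

Lemma dot_circ r u t : dot u u = 1 -> dot u (circ r u t) = r * (1 - t ^+ 2) / (1 + t ^+ 2).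
Proof.
move=> u1; transitivity (r * (1 - t ^+ 2) / (1 + t ^+ 2) * dot u u); last by rewrite u1 mulr1.
by rewrite /dot !coordE /=; ring.
Qed.

Lemma cross_circ r u t : dot u u = 1 -> cross u (circ r u t) = r * (2 * t) / (1 + t ^+ 2).
Proof.
move=> u1; transitivity (r * (2 * t) / (1 + t ^+ 2) * dot u u); last by rewrite u1 mulr1.
by rewrite /cross /dot !coordE /=; ring.
Qed.

Lemma frameE u w : dot u u = 1 -> w = dot u w *: u + cross u w *: perp u.
Proof.
move=> u1; rewrite -[LHS]scale1r -u1.
by apply: pair_eq; rewrite !coordE /dot /cross /=; ring.
Qed.

Lemma enorm_circ r u t : 0 < r -> dot u u = 1 -> enorm (circ r u t) = r.
Proof.
move=> r0 u1; apply/eqP; rewrite -(@eqrXn2 _ 2) // ?enorm_ge0 ?ltW // enorm_sq; apply/eqP.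
have -> : dot (circ r u t) (circ r u t) = (r / (1 + t ^+ 2)) ^+ 2 * ((1 - t ^+ 2) ^+ 2
  + (2 * t) ^+ 2) * dot u u.
  by rewrite /circ /dot !coordE /=; ring.
rewrite u1 mulr1; field; exact: lt0r_neq0 (sqr1_gt0 t).
Qed.

(** The half-angle formula: the tangent of half the angle from [u] is the sine over one plus the
    cosine, both scaled by [r]. *)
Lemma circ_param r u t : 0 < r -> dot u u = 1 ->
  t = cross u (circ r u t) / (r + dot u (circ r u t)).
Proof.
move=> r0 u1; rewrite dot_circ // cross_circ //.
have h := sqr1_gt0 t.
have -> : r + r * (1 - t ^+ 2) / (1 + t ^+ 2) = 2 * r / (1 + t ^+ 2) by field; exact: lt0r_neq0.
field; rewrite (lt0r_neq0 h) (lt0r_neq0 r0) //.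
Qed.

Lemma circ_of_param r u w : 0 < r -> dot u u = 1 -> enorm w + dot u w != 0 -> w <> 0 ->
  circ r u (cross u w / (enorm w + dot u w)) = (r / enorm w) *: w.
Proof.
move=> r0 u1 nz w0; have n0 := enorm_gt0 w0.
have E := frameE w u1; rewrite {5}E /circ.
have : enorm w ^+ 2 = dot u w ^+ 2 + cross u w ^+ 2.
  rewrite enorm_sq -[LHS]mulr1 -u1; rewrite /dot /cross; ring.
move: (dot u w) (cross u w) (enorm w) n0 nz {E} => C S n n0 nz h.
have nz2 : n ^+ 2 + C ^+ 2 + 2 * n * C + S ^+ 2 != 0.
  have -> : n ^+ 2 + C ^+ 2 + 2 * n * C + S ^+ 2 = 2 * n * (n + C)
    by rewrite -[S ^+ 2](addrK (C ^+ 2)) [S ^+ 2 + _]addrC -h; ring.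
  by rewrite !mulf_neq0 // ?pnatr_eq0 // gt_eqF.
have e1 : 1 + (S / (n + C)) ^+ 2 = 2 * n / (n + C).
  transitivity (((n + C) ^+ 2 + S ^+ 2) / (n + C) ^+ 2); first by field.
  have -> : S ^+ 2 = n ^+ 2 - C ^+ 2 by rewrite h; ring.
  by field.
have e2 : 1 - (S / (n + C)) ^+ 2 = 2 * C / (n + C).
  transitivity (((n + C) ^+ 2 - S ^+ 2) / (n + C) ^+ 2); first by field.
  have -> : S ^+ 2 = n ^+ 2 - C ^+ 2 by rewrite h; ring.
  by field.
rewrite e1 e2; apply: pair_eq; rewrite !coordE /=; field; rewrite nz gt_eqF //.
Qed.

(** For [s] near [t] and [r] nonzero the sign is that of [s - t]: the parameter runs
    counterclockwise. *)
Lemma cross_circ2 r u s t : dot u u = 1 -> cross (circ r u t) (circ r u s) =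
  r ^+ 2 * (2 * (s - t) * (1 + s * t)) / ((1 + t ^+ 2) * (1 + s ^+ 2)).
Proof.
move=> u1; transitivity (r ^+ 2 * (2 * (s - t) * (1 + s * t)) / ((1 + t ^+ 2) * (1
  + s ^+ 2)) * dot u u).
  rewrite /cross /circ /dot !coordE /=; field.
  by rewrite !lt0r_neq0 ?sqr1_gt0.
by rewrite u1 mulr1.
Qed.

Lemma circ_dist r u s t : 0 < r -> dot u u = 1 ->
  enorm (circ r u s - circ r u t) <= 2 * r * `|s - t|.
Proof.
move=> r0 u1; have b0 : 0 <= 2 * r * `|s - t| by rewrite !mulr_ge0 // ltW.
rewrite le_sqr_sqrt ?enorm_ge0 // enorm_sq exprMn real_normK ?num_real //.
have -> : dot (circ r u s - circ r u t) (circ r u s - circ r u t) =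
   (2 * r) ^+ 2 * (s - t) ^+ 2 / ((1 + t ^+ 2) * (1 + s ^+ 2)) * dot u u.
  by rewrite /circ /dot !coordE /=; field; rewrite !lt0r_neq0 ?sqr1_gt0.
rewrite u1 mulr1 ler_pdivrMr; last by rewrite mulr_gt0 ?sqr1_gt0.
apply: ler_peMr; first by rewrite mulr_ge0 ?sqr_ge0.
have h1 := sqr_ge0 t; have h2 := sqr_ge0 s; have h3 := mulr_ge0 h1 h2; lra.
Qed.

(** Both ends of the parameter line tend to the missed point, which closes up the circle. *)
Lemma circ_far r u s : 0 < r -> dot u u = 1 -> enorm (circ r u s + r *: u) * `|s| <= 2 * r.
Proof.
move=> r0 u1; rewrite le_sqr_sqrt ?mulr_ge0 ?enorm_ge0 ?(ltW r0) //.
rewrite exprMn enorm_sq real_normK ?num_real //.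
have -> : dot (circ r u s + r *: u) (circ r u s + r *: u) = (2 * r) ^+ 2 / (1 + s ^+ 2) * dot u u.
  by rewrite /circ /dot !coordE /=; field; rewrite !lt0r_neq0 ?sqr1_gt0.
rewrite u1 mulr1 mulrAC ler_pdivrMr ?sqr1_gt0 //.
by apply: ler_wpM2l; [exact: sqr_ge0 | lra].
Qed.

End Parity.

(** * Even degree of a vertex point *)

Section Degree.
Variable R : realType.
Implicit Types (x y z u v w p q d : R * R) (s t k r e : R) (b : bool) (f g : set (R * R)).
Variable phi : R * R -> R * R.
Hypothesis fold : local_flat_folding phi.
Hypothesis fin_vertices : finite_set (vertex_point phi).

Definition incident p f := exists v b, stub_edge phi p v b f.

(** The orientation of [phi], as a boolean; it is false at points that are not unfolded. *)
Definition direct x : bool := `[< exists a w, orth 1 a /\ germ phi x 1 a w >].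

Lemma direct_germ x o a w : orth o a -> germ phi x o a w -> direct x = (o == 1).
Proof.
move=> oa g; apply/asboolP/eqP => [[a' [w' [oa' g']]]|o1].
  by have [] := germ_unique oa g g'.
by exists a, w; rewrite -o1.
Qed.

Lemma opp_eq1 o a : orth o a -> (- o == 1 :> R) = ~~ (o == 1).
Proof.
have N : (-1 == 1 :> R) = false by apply/eqP; lra.
by move=> [[->|->] _]; rewrite ?opprK eqxx N.
Qed.

(** The edges at [p] correspond to the crease points of a small circle. Cut at an unfolded point,
    the circle becomes the real line, on which [direct] jumps exactly at the edges and takes the
    same value near both ends. *)
Lemma vertex_even_degree p (l : seq (set (R * R))) : vertex_point phi p ->
  uniq l -> (forall f, f \in l <-> incident p f) -> ~~ odd (size l).
Proof.
move=> vp ul hl; have [e [e0 rad uc hom]] := vertex_neighborhood fold fin_vertices vp.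
pose r := e / 2; have r0 : 0 < r by rewrite /r; lra.
have re : r < e by rewrite /r; lra.
have inball X : enorm X = r -> enorm (p + X - p) < e by rewrite addrC addKr => ->.
have offp X : enorm X = r -> p + X <> p.
  by move=> Xr /(congr1 (fun x => x - p)); rewrite addrC addKr subrr => X0; move: r0;
    rewrite -Xr X0 enorm0 ltxx.
have circle_crease v b f : stub_edge phi p v b f -> crease_point phi (p + (r / enorm v) *: v).
  move=> [_ v0 fE cr _]; have n0 := enorm_gt0 v0.
  have rn : 0 < r / enorm v by rewrite divr_gt0.
  have Xr : enorm ((r / enorm v) *: v) = r by rewrite enormZ gtr0_norm // divfK // gt_eqF.
  (* A contraction that brings the circle point onto the edge, whatever its length: its parameter
     along [v] becomes at most 1/2. *)
  pose t := Num.min 1 (enorm v / r / 2).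
  have t0 : 0 < t by rewrite lt_min ltr01 !divr_gt0.
  have t1 : t <= 1 by rewrite ge_min lexx.
  have t2 : t <= enorm v / r / 2 by rewrite ge_min lexx orbT.
  have t01 : 0 < t <= 1 by rewrite t0.
  apply/(hom _ t (offp _ Xr) (inball _ Xr) t01); apply: cr; rewrite fE.
  exists (t * (r / enorm v)); last by rewrite /seg [p + _ - p]addrC addKr scalerA.
  split; first exact: mulr_gt0.
  right; apply: (@le_lt_trans _ _ (enorm v / r / 2 * (r / enorm v))).
    by rewrite ler_wpM2r // ltW.
  have -> : enorm v / r / 2 * (r / enorm v) = 1 / 2 by field; rewrite !gt_eqF.
  lra.
have circle_edge X : enorm X = r -> crease_point phi (p + X) ->
    exists f c b, 0 < c /\ stub_edge phi p (c *: X) b f.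
  move=> Xr cX; apply: stub_edge_extend => //.
    by move=> X0; move: r0; rewrite -Xr X0 enorm0 ltxx.
  move=> t t01; have := (hom _ t (offp _ Xr) (inball _ Xr) t01).2 cX.
  by rewrite /seg [p + _ - p]addrC addKr.
have [V hV] : exists V : set (R * R) -> R * R, forall f, incident p f ->
  exists b, stub_edge phi p (V f) b f.
  have : forall f, exists v, incident p f -> exists b, stub_edge phi p v b f.
    move=> f; have [[v [b E]]|n] := pselect (incident p f); first by exists v; exists b.
    by exists 0 => /n.
  by move=> /choice[V hV]; exists V.
have V0 f : f \in l -> V f <> 0 by move=> /hl /hV[b []].
pose param u f := cross u (V f) / (enorm (V f) + dot u (V f)).
have ur u : dot u u = 1 -> enorm (r *: u) = r.
  move=> u1; have h : enorm u ^+ 2 = 1 by rewrite enorm_sq.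
  rewrite enormZ gtr0_norm //; have /eqP := h; rewrite sqrf_eq1 => /orP[/eqP ->|/eqP h1];
    first by rewrite mulr1.
  by have := enorm_ge0 u; rewrite h1; lra.
have param_mem u t : dot u u = 1 -> crease_point phi (p + circ r u t) -> t \in map (param u) l.
  move=> u1 /(circle_edge _ (enorm_circ t r0 u1))[f [c [b [c0 E]]]].
  have fi : incident p f by exists (c *: circ r u t), b.
  have fl : f \in l by apply/hl.
  have [b' E'] := hV f fi; have [c' c'0 VE] := stub_edge_direction E E'.
  apply/mapP; exists f => //; rewrite /param VE scalerA.
  have cc : 0 < c' * c by apply: mulr_gt0.
  rewrite enormZ gtr0_norm // enorm_circ //.
  have -> : cross u ((c' * c) *: circ r u t) = (c' * c) * cross u (circ r u t)
    by rewrite /cross !coordE; ring.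
  have -> : dot u ((c' * c) *: circ r u t) = (c' * c) * dot u (circ r u t)
    by rewrite /dot !coordE; ring.
  by rewrite -mulrDr -mulf_div divff ?gt_eqF // mul1r; apply: circ_param.
have bound (T : seq R) : exists M : R, forall t, t \in T -> `|t| < M.
  elim: T => [|t T [M hM]]; first by exists 0.
  exists (Num.max M (`|t| + 1)) => s; rewrite inE => /orP[/eqP ->|/hM h].
    by rewrite lt_max; apply/orP; right; lra.
  by rewrite lt_max h.
(* A place to cut the circle: relative to (1, 0) the finitely many edges have bounded parameters,
   and [M] exceeds them all. *)
have [u [u1 ncr]] : exists u, dot u u = 1 /\ ~ crease_point phi (p - r *: u).
  have i1 : dot ((1, 0) : R * R) ((1, 0) : R * R) = 1 by rewrite /dot /=; ring.
  have [M hM] := bound (map (param (1, 0)) l).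
  exists ((- r^-1) *: circ r (1, 0) M); split.
    rewrite -enorm_sq enormZ enorm_circ // normrN gtr0_norm ?invr_gt0 //.
    by rewrite mulVf ?gt_eqF // expr1n.
  rewrite scalerA mulrN divff ?gt_eqF // scaleN1r opprK => /(param_mem _ _ i1)/hM.
  by move=> h; have := ler_norm M; rewrite leNgt h.
pose T := map (param u) l.
(* This denominator of [param] vanishes only in the direction [- u], where there is no crease. *)
have nz f : f \in l -> enorm (V f) + dot u (V f) != 0.
  move=> fl; apply/eqP => h0; apply: ncr.
  have n0 := enorm_gt0 (V0 f fl).
  have VE : V f = - enorm (V f) *: u.
    apply/eqP; rewrite -subr_eq0; apply/eqP; apply: dot_eq0; rewrite scaleNr opprK.
    transitivity (dot (V f) (V f) + 2 * enorm (V f) * dot u (V f) + enorm (V f) ^+ 2 * dot u u).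
      by rewrite /dot !coordE; ring.
    rewrite u1 -enorm_sq; have -> : dot u (V f) = - enorm (V f) by lra.
    by ring.
  have [b E] := hV f ((hl f).1 fl); have := circle_crease _ _ _ E.
  rewrite {2}VE scalerA; have -> : r / enorm (V f) * - enorm (V f) = - r by field; rewrite gt_eqF.
  by rewrite scaleNr.
have circE f : f \in l -> circ r u (param u f) = (r / enorm (V f)) *: V f.
  by move=> fl; apply: circ_of_param => //; [exact: nz | exact: V0].
have memT t : t \in T <-> crease_point phi (p + circ r u t).
  split; last exact: param_mem.
  move=> /mapP[f fl ->]; rewrite circE //.
  by have [b E] := hV f ((hl f).1 fl); apply: circle_crease E.
have uT : uniq T.
  rewrite map_inj_in_uniq // => f g fl gl h.
  have := circE f fl; rewrite h circE // => hh.
  have [b E] := hV f ((hl f).1 fl); have [b' E'] := hV g ((hl g).1 gl).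
  have nf := enorm_gt0 (V0 f fl); have ng := enorm_gt0 (V0 g gl).
  have gE : V g = (enorm (V g) / enorm (V f)) *: V f.
    have -> : enorm (V g) / enorm (V f) = enorm (V g) / r * (r / enorm (V f)) by field;
      rewrite !gt_eqF.
    rewrite -scalerA -hh scalerA.
    have -> : enorm (V g) / r * (r / enorm (V g)) = 1 by field; rewrite !gt_eqF.
    by rewrite scale1r.
  rewrite gE in E'; apply: (stub_edge_same_direction _ E E'); exact: divr_gt0.
pose sigma t := direct (p + circ r u t).
have shift X Y : p + X - (p + Y) = X - Y by rewrite opprD addrACA subrr add0r.
have near (n : R) t : 0 < n -> exists2 h : R, 0 < h & forall s, `|s - t| < h ->
    enorm (p + circ r u s - (p + circ r u t)) < n.
  move=> n0; have rr : 0 <= 2 * r by lra.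
  have [h h0 hh] := small_step rr n0.
  exists h => // s st; rewrite shift; apply: le_lt_trans (circ_dist s t r0 u1) _.
  by rewrite mulrC; apply: hh.
have unfoldedT t : t \notin T -> unfolded_point phi (p + circ r u t).
  move=> /negP tT; have cr := enorm_circ t r0 u1.
  by case: (uc _ (offp _ cr) (inball _ cr)) => // /memT.
have loc t : exists2 h : R, 0 < h & exists c : bool, forall s, `|s - t| < h ->
    [/\ s < t -> sigma s = c, t < s -> sigma s = c (+) (t \in T),
        s != t -> s \notin T & t \notin T -> s = t -> sigma s = c].
  have [tT|tT] := boolP (t \in T); last first.
    have /unfolded_germ[ o [a [w [oa /germ_open[n n0 hn]]]]] := unfoldedT t tT.
    have [h h0 hh] := near n t n0.
    exists h => //; exists (o == 1) => s /hh/hn gs.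
    have sE : sigma s = (o == 1) by apply: direct_germ gs.
    split=> //; first by rewrite addbF.
    move=> _; apply/negP => /memT/crease_not_unfolded; apply.
    by apply/unfolded_germ; exists o, a, w.
  have ct := (memT t).1 tT; have cr := enorm_circ t r0 u1.
  have [n [d [ o [a [w [a' [w' [n0 d0 oa oa' hn]]]]]]]] :=
    crease_structure (folding_radial fold) ct.
  (* The crease line through a point of the circle is radial, because the points of the same radius
     just inside the circle are crease points too. *)
  have dX : cross d (circ r u t) = 0.
    have [n' [d' [n'0 d'0 line]]] := crease_line fold ct.
    have m0 : 0 < Num.min n n' by rewrite lt_min n0.
    have [k k0 hk] := small_step (ltW r0) m0.
    pose s := Num.min (k / 2) (1 / 2).
    have s0 : 0 < s by rewrite lt_min; apply/andP; split; lra.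
    have sk : s <= k / 2 by rewrite ge_min lexx.
    have s1 : s <= 1 / 2 by rewrite ge_min lexx orbT.
    have t01 : 0 < 1 - s <= 1 by apply/andP; split; lra.
    have cs := (hom _ _ (offp _ cr) (inball _ cr) t01).2 ct.
    have sE : seg p (p + circ r u t) (1 - s) - (p + circ r u t) = (- s) *: circ r u t.
      by rewrite /seg; apply: pair_eq; rewrite !coordE; ring.
    have sn : enorm (seg p (p + circ r u t) (1 - s) - (p + circ r u t)) < n.
      have : `|s| * r < Num.min n n' by apply: hk; rewrite gtr0_norm //; lra.
      by rewrite lt_min sE enormZ normrN cr => /andP[].
    have [h1 h2 _] := hn _ sn.
    have [c|c|] := ltgtP (cross d (seg p (p + circ r u t) (1 - s) - (p + circ r u t))) 0.
    - exfalso; apply: (crease_not_unfolded cs); apply/unfolded_germ.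
      by exists (- o), a', w'; split=> //; apply: h2.
    - exfalso; apply: (crease_not_unfolded cs); apply/unfolded_germ.
      by exists o, a, w; split=> //; apply: h1.
    rewrite sE; have -> : cross d (- s *: circ r u t) = - s * cross d (circ r u t)
      by rewrite /cross !coordE; ring.
    by move=> /eqP; rewrite mulf_eq0 oppr_eq0 (gt_eqF s0) => /eqP.
  (* [d] being radial, [c] is nonzero and its sign tells whether [d] points outwards; the side of
     the crease will be the sign of [c * (s - t)]. *)
  pose c := dot d (circ r u t).
  have cN : c != 0.
    apply/eqP => c0; apply: d0; apply: dot_eq0.
    have h : dot d d * dot (circ r u t) (circ r u t) = c ^+ 2 + cross d (circ r u t) ^+ 2.
      by rewrite /c /dot /cross; ring.
    move: h; rewrite c0 dX expr0n addr0 -[dot (circ _ _ _) _]enorm_sq cr => /eqP.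
    by rewrite mulf_eq0 expf_eq0 /= (gt_eqF r0) orbF => /eqP.
  have crossE s : cross d (p + circ r u s - (p + circ r u t)) =
      c * (2 * (s - t) * (1 + s * t)) / ((1 + t ^+ 2) * (1 + s ^+ 2)).
    have rN : r ^+ 2 != 0 by rewrite expf_eq0 /= gt_eqF.
    apply: (mulfI rN); rewrite shift.
    transitivity (c * cross (circ r u t) (circ r u s)).
      have -> : cross d (circ r u s - circ r u t) = cross d (circ r u s) - cross d (circ r u t).
        by rewrite /cross !coordE; ring.
      rewrite dX subr0 -{1}cr enorm_sq.
      transitivity (c * cross (circ r u t) (circ r u s)
        + dot (circ r u t) (circ r u s) * cross d (circ r u t)).
        by rewrite /c /dot /cross; ring.
      by rewrite dX mulr0 addr0.
    by rewrite cross_circ2 //; field; rewrite !lt0r_neq0 ?sqr1_gt0.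
  have [h h0 hh] := near n t n0.
  (* The bound 1 on the distance from [s] to [t] keeps [1 + s * t] positive. *)
  exists (Num.min h 1); first by rewrite lt_min h0 ltr01.
  have signE s : `|s - t| < 1 ->
    exists2 k : R, 0 < k & cross d (p + circ r u s - (p + circ r u t)) = c * (s - t) * k.
    rewrite ltr_norml => /andP[h1 h2].
    exists (2 * (1 + s * t) / ((1 + t ^+ 2) * (1 + s ^+ 2))).
      rewrite divr_gt0 // ?mulr_gt0 ?sqr1_gt0 //.
      have -> : 1 + s * t = 1 + ((s + t) ^+ 2 - (s - t) ^+ 2) / 4 by field.
      have k1 := sqr_ge0 (s + t).
      have k2 : (s - t) ^+ 2 < 1.
        by have := mulr_gt0 (_ : 0 < 1 - (s - t)) (_ : 0 < 1 + (s - t)); rewrite expr2; lra.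
      lra.
    by rewrite crossE; ring.
  have germs s : `|s - t| < Num.min h 1 ->
     (0 < c * (s - t) -> germ phi (p + circ r u s) o a w) /\
     (c * (s - t) < 0 -> germ phi (p + circ r u s) (- o) a' w').
    rewrite lt_min => /andP[/hh/hn[h1 h2 _] /signE[k k0 E]]; rewrite E in h1 h2.
    by split=> ?; [apply: h1; rewrite mulr_gt0 | apply: h2; rewrite pmulr_llt0].
  have oN := opp_eq1 oa.
  have sT s : `|s - t| < Num.min h 1 -> s != t -> s \notin T.
    move=> /germs[h1 h2] st; apply/negP => /memT/crease_not_unfolded; apply; apply/unfolded_germ.
    have : c * (s - t) != 0 by rewrite mulf_neq0 // subr_eq0.
    by rewrite neq_lt => /orP[/h2|/h1] g; [exists (- o), a', w' | exists o, a, w].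
  have [c0|c0] : 0 < c \/ c < 0 by move: cN; rewrite neq_lt => /orP[]; [right|left].
    exists (~~ (o == 1)) => s sh; have [h1 h2] := germs s sh; split.
    - move=> st; rewrite -oN; apply: (direct_germ oa'); apply: h2.
      by rewrite pmulr_rlt0 // subr_lt0.
    - move=> ts; rewrite addbT negbK; apply: (direct_germ oa); apply: h1.
      by rewrite pmulr_rgt0 // subr_gt0.
    - exact: sT.
    - by [].
  exists (o == 1) => s sh; have [h1 h2] := germs s sh; split.
  - move=> st; apply: (direct_germ oa); apply: h1.
    by rewrite nmulr_rgt0 // subr_lt0.
  - move=> ts; rewrite addbT -oN; apply: (direct_germ oa'); apply: h2.
    by rewrite nmulr_rlt0 // subr_gt0.
  - exact: sT.
  - by [].
have nr : enorm (- (r *: u)) = r by rewrite enormN ur.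
have /unfolded_germ[ o [a [w [oa /germ_open[n n0 hn]]]]] : unfolded_point phi (p - r *: u).
  by case: (uc _ (offp _ nr) (inball _ nr)).
have [M0 hM0] := bound T.
(* Beyond all jumps, and so large that by [circ_far] the points of parameters [M] and [- M] are
   within [n] of the missed point. *)
pose M := Num.max (Num.max M0 1) (2 * r / n + 1).
have M1 : 1 <= M by rewrite /M !le_max lexx orbT.
have M2 : 2 * r / n < M by rewrite /M lt_max; apply/orP; right; lra.
have hM t : t \in T -> `|t| < M by move=> /hM0 h; rewrite /M !lt_max h.
have far t : `|t| = M -> sigma t = (o == 1).
  move=> tM; apply: (direct_germ oa); apply: hn; rewrite shift opprK.
  have M0' : 0 < M by lra.
  have := circ_far t r0 u1; rewrite tM -ler_pdivlMr // => h; apply: le_lt_trans h _.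
  by rewrite ltr_pdivrMr // [n * M]mulrC -ltr_pdivrMr.
have aM : M \notin T by apply/negP => /hM; rewrite gtr0_norm ?ltxx //; lra.
have aN : - M \notin T by apply/negP => /hM; rewrite normrN gtr0_norm ?ltxx //; lra.
have := alternating_parity uT (_ : - M < M) aN aM loc.
rewrite !far ?normrN ?gtr0_norm //; try lra.
have -> : count (fun t => - M < t < M) T = size T.
  by apply/eqP; rewrite -all_count; apply/allP => t /hM; rewrite ltr_norml.
rewrite size_map; case: (odd _) => //; rewrite addbT => /(_ (ltac:(lra))).
by case: (o == 1).
Qed.

End Degree.

(** * Distance between edges *)

Section ClosedStubs.
Variable R : realType.
Implicit Types (x y z u v w p q d : R * R) (s t k r e : R) (b : bool).

Definition in_range b t := 0 <= t /\ (b \/ t <= 1).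
Definition at_end b t := t = 0 \/ (b = false /\ t = 1).

(** The squared distance is quadratic in the parameter and minimal at [k0], which is clamped to the
    range. *)
Lemma nearest_point x q v b : v <> 0 -> exists2 k : R, in_range b k &
  forall j : R, in_range b j -> enorm (x - (q + k *: v)) <= enorm (x - (q + j *: v)).
Proof.
move=> v0; have vv := dot_gt0 v0.
pose k0 := dot (x - q) v / dot v v.
have E j : dot (x - (q + j *: v)) (x - (q + j *: v)) =
    dot (x - q) (x - q) - k0 ^+ 2 * dot v v + dot v v * (j - k0) ^+ 2.
  have -> : dot (x - (q + j *: v)) (x - (q + j *: v)) =
    dot (x - q) (x - q) - 2 * j * dot (x - q) v + j ^+ 2 * dot v v.
    by rewrite /dot !coordE; ring.
  have -> : dot (x - q) v = k0 * dot v v by rewrite /k0 divfK // gt_eqF.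
  by ring.
have red k : in_range b k -> (forall j, in_range b j -> (k - k0) ^+ 2 <= (j - k0) ^+ 2) ->
   exists2 k : R, in_range b k &
  forall j : R, in_range b j -> enorm (x - (q + k *: v)) <= enorm (x - (q + j *: v)).
  by move=> hk h; exists k => // j /h hj; rewrite enorm_le !E lerD2l ler_wpM2l // ltW.
have [kneg|kpos] := leP k0 0.
  apply: (red 0); first by split => //; right; rewrite ler01.
  move=> j [j0 _]; rewrite -subr_ge0.
  have -> : (j - k0) ^+ 2 - (0 - k0) ^+ 2 = j * j + 2 * (j * - k0) by ring.
  by rewrite addr_ge0 ?mulr_ge0 // oppr_ge0.
case: (boolP (b || (k0 <= 1))) => [/orP hb|].
  by apply: (red k0) => [|j _]; [split=> //; exact: ltW | rewrite subrr expr0n sqr_ge0].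
rewrite negb_or -ltNge => /andP[/negbTE bf k1]; apply: (red 1).
  by split; [exact: ler01 | right].
move=> j [j0]; rewrite bf => -[//|j1]; rewrite -subr_ge0.
have -> : (j - k0) ^+ 2 - (1 - k0) ^+ 2 = (1 - j) * (1 - j) + 2 * ((1 - j) * (k0 - 1)) by ring.
by rewrite addr_ge0 ?mulr_ge0 // subr_ge0 // ltW.
Qed.

(** Each pair holds the values at 0 and 1 of an affine function; [s] is the first zero among those
    that end negative. *)
Lemma first_exit (L : seq (R * R)) :
  (forall g, g \in L -> 0 <= g.1) -> (exists2 g, g \in L & g.2 < 0) ->
  exists2 s : R, 0 <= s < 1 & (forall g, g \in L -> 0 <= g.1 + s * (g.2 - g.1)) /\
    exists2 g, g \in L & g.1 + s * (g.2 - g.1) = 0.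
Proof.
move=> pos [g0 g0L g0n].
have : [seq g <- L | g.2 < 0] != [::].
  by apply/eqP => h; have := in_nil g0; rewrite -h mem_filter g0n g0L.
move=> /(seq_argmin (fun g : R * R => g.1 / (g.1 - g.2)))[g].
rewrite mem_filter => /andP[gn gL] gmin.
have den h : h \in L -> h.2 < 0 -> 0 < h.1 - h.2 by move=> /pos h1 h2; lra.
have gd := den g gL gn; have gp := pos g gL.
exists (g.1 / (g.1 - g.2)).
  by rewrite divr_ge0 ?(ltW gd) //= ltr_pdivrMr // mul1r; lra.
set s := g.1 / (g.1 - g.2) in gmin *.
have s0 : 0 <= s by rewrite /s divr_ge0 ?(ltW gd).
have s1 : s < 1 by rewrite /s ltr_pdivrMr // mul1r; lra.
split; last by exists g => //; rewrite /s; field; rewrite gt_eqF.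
move=> h hL; have hp := pos h hL; have [hn|hn] := ltP h.2 0.
  have := gmin h; rewrite mem_filter hn hL => /(_ isT).
  by rewrite ler_pdivlMr ?den // => ?; lra.
have := mulr_ge0 s0 hn; have : 0 <= (1 - s) * h.1 by rewrite mulr_ge0 // subr_ge0 ltW.
lra.
Qed.

(* The difference of the two points is an affine function of the parameters; move
   towards a zero of it, or along a direction in which it is constant if the two
   lines are parallel. *)
Lemma slide_to_end p v b q w b' s t : v <> 0 -> w <> 0 ->
  (forall i j, in_range b i -> in_range b' j -> p + i *: v <> q + j *: w) ->
  in_range b s -> in_range b' t ->
  exists i j, [/\ in_range b i, in_range b' j,
    enorm (p + i *: v - (q + j *: w)) <= enorm (p + s *: v - (q + t *: w)) &
    at_end b i \/ at_end b' j].
Proof.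
move=> v0 w0 dis [s0 sb] [t0 tb].
have [s' [t' [mu [mu01 out E]]]] : exists s' t' mu, [/\ 0 <= mu <= 1,
    ~ (in_range b s' /\ in_range b' t') &
    p + s' *: v - (q + t' *: w) = mu *: (p + s *: v - (q + t *: w))].
  have [c0|c0] := eqVneq (cross v w) 0.
    have vv := dot_gt0 v0.
    have wE : w = (dot v w / dot v v) *: v.
      have h : dot v v *: w = dot v w *: v.
        have -> : dot v v *: w = dot v w *: v + cross v w *: perp v.
          by apply: pair_eq; rewrite !coordE /dot /cross /=; ring.
        by rewrite c0 scale0r addr0.
      by rewrite mulrC -scalerA -h scalerA mulVf ?gt_eqF // scale1r.
    have kN : dot v w / dot v v != 0.
      by apply/eqP => k0; apply: w0; rewrite wE k0 scale0r.
    move: wE kN; set k := dot v w / dot v v => wE kN.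
    (* Parallel lines: [t] moves along with [s] so that the difference is constant, and -1 is
       outside every range. *)
    exists (-1), (t - (s + 1) / k), 1; split; first by rewrite ler01 lexx.
      by move=> [[h _] _]; move: h; rewrite oppr_ge0 leNgt ltr01.
    by rewrite wE scale1r; apply: pair_eq; rewrite !coordE; field.
  (* The intersection of the two lines, by Cramer's rule; by disjointness it is not within both
     ranges. *)
  exists (cross (q - p) w / cross v w), (cross (q - p) v / cross v w), 0.
  have E : p + (cross (q - p) w / cross v w) *: v - (q + (cross (q - p) v / cross v w) *: w) = 0.
    by move: c0; rewrite /cross => c0; apply: pair_eq; rewrite !coordE; field.
  split; first by rewrite lexx ler01.
    by move=> [h1 h2]; apply: (dis _ _ h1 h2); apply/eqP; rewrite -subr_eq0 E.
  by rewrite E scale0r.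
(* The inequalities defining the two ranges, evaluated at the start and at the target. *)
pose L := [:: (s, s'); (t, t')] ++ (if b then [::] else [:: (1 - s, 1 - s')])
  ++ (if b' then [::] else [:: (1 - t, 1 - t')]).
have Lpos g : g \in L -> 0 <= g.1.
  rewrite /L !mem_cat !inE -orbA => /or4P[/eqP -> //|/eqP -> //||].
    by case: b sb {L dis out} => //= -[//|s1]; rewrite inE => /eqP -> /=; lra.
  by case: b' tb {L dis out} => //= -[//|t1]; rewrite inE => /eqP -> /=; lra.
have [|r /andP[r0 r1] [Lr [g gL g0]]] := first_exit Lpos.
  apply: contrapT => none.
  have all_pos g : g \in L -> 0 <= g.2.
    by move=> gL; rewrite leNgt; apply/negP => gn; apply: none; exists g.
  apply: out; split; split.
  - by apply: (all_pos (s, s')); rewrite /L !mem_cat !inE eqxx.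
  - case: b @L {dis sb Lpos none} all_pos => [L|L] h; [by left | right].
    have : 0 <= (1 - s, 1 - s').2 by apply: h; rewrite /L !mem_cat !inE eqxx !orbT.
    by rewrite /= subr_ge0.
  - by apply: (all_pos (t, t')); rewrite /L !mem_cat !inE eqxx orbT.
  - case: b' @L {dis tb Lpos none} all_pos => [L|L] h; [by left | right].
    have : 0 <= (1 - t, 1 - t').2 by apply: h; rewrite /L !mem_cat !inE eqxx !orbT.
    by rewrite /= subr_ge0.
exists (s + r * (s' - s)), (t + r * (t' - t)); split.
- split; first by apply: (Lr (s, s')); rewrite /L !mem_cat !inE eqxx.
  case: b @L {dis sb Lpos gL out} Lr => [L|L] h; [by left | right].
  have : 0 <= (1 - s, 1 - s').1 + r * ((1 - s, 1 - s').2 - (1 - s, 1 - s').1).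
    by apply: h; rewrite /L !mem_cat !inE eqxx !orbT.
  by rewrite /=; lra.
- split; first by apply: (Lr (t, t')); rewrite /L !mem_cat !inE eqxx orbT.
  case: b' @L {dis tb Lpos gL out} Lr => [L|L] h; [by left | right].
  have : 0 <= (1 - t, 1 - t').1 + r * ((1 - t, 1 - t').2 - (1 - t, 1 - t').1).
    by apply: h; rewrite /L !mem_cat !inE eqxx !orbT.
  by rewrite /=; lra.
- have -> : p + (s + r * (s' - s)) *: v - (q + (t + r * (t' - t)) *: w) =
     (1 - r) *: (p + s *: v - (q + t *: w)) + r *: (p + s' *: v - (q + t' *: w)).
    by apply: pair_eq; rewrite !coordE; ring.
  rewrite E scalerA -scalerDl enormZ; case/andP: mu01 => m0 m1.
  rewrite ler_piMl ?enorm_ge0 // ler_norml.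
  have h1 := mulr_ge0 r0 m0; have h2 : 0 <= r * (1 - mu) by rewrite mulr_ge0 // subr_ge0.
  by apply/andP; split; lra.
- move: gL; rewrite /L !mem_cat !inE -orbA => /or4P[/eqP gE|/eqP gE||]; rewrite ?gE /= in g0.
  + by left; left.
  + by right; left.
  + case: b {L dis sb Lpos Lr out} => //; rewrite inE => /eqP gE; rewrite gE /= in g0.
    by left; right; split=> //; lra.
  + case: b' {L dis tb Lpos Lr out} => //; rewrite inE => /eqP gE; rewrite gE /= in g0.
    by right; right; split=> //; lra.
Qed.

End ClosedStubs.

(** * Connectivity *)

Section Counting.

Lemma count_sum (T : Type) (P : pred T) (l : seq T) : count P l = (\sum_(i <- l) P i)%N.
Proof. by elim: l => [|i l IH]; rewrite ?big_nil // big_cons /= IH. Qed.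

Lemma odd_sum_congr (T : eqType) (F G : T -> nat) (l : seq T) :
  (forall i, i \in l -> odd (F i) = odd (G i)) ->
  odd (\sum_(i <- l) F i)%N = odd (\sum_(i <- l) G i)%N.
Proof.
elim: l => [|i l IH] h; rewrite ?big_nil // !big_cons !oddD h ?mem_head // IH // => j jl.
by apply: h; rewrite inE jl orbT.
Qed.

(** Handshake argument: the degrees over [xs] add up to the numbers of ends in [xs] of the edges,
    and modulo 2 only the edges with exactly one such end count. *)
Lemma even_boundary (T U : eqType) (I : T -> U -> bool) (xs : seq T) (es : seq U) :
  (forall q, q \in xs -> ~~ odd (count (I q) es)) ->
  (forall f, f \in es -> (count (I^~ f) xs <= 2)%N) ->
  ~~ odd (count (fun f => count (I^~ f) xs == 1%N) es).
Proof.
move=> deg le2.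
rewrite count_sum (odd_sum_congr (G := fun f => count (I^~ f) xs)); last first.
  by move=> f /le2; case: (count _ _) => [|[|[|]]].
rewrite (eq_bigr (fun f => (\sum_(q <- xs) I q f)%N)); last by move=> f _; rewrite count_sum.
rewrite exchange_big (odd_sum_congr (G := fun=> 0%N)) => [|q /deg]; first by rewrite big1.
by rewrite count_sum => /negbTE.
Qed.

Lemma uniq_card_le (T : choiceType) (l : seq T) (A : set T) n : uniq l ->
  (forall x, x \in l -> A x) -> A #<= `I_n -> (size l <= n)%N.
Proof.
move=> ul lA An; rewrite -card_le_II.
have /card_eq_fsetP lE : (#|` [fset x in l]%fset| = size l)%N by rewrite card_fseq undup_id.
rewrite -(card_le_eql lE); apply: card_le_trans An; apply: subset_card_le => x /=.
by rewrite inE; apply: lA.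
Qed.

End Counting.

(** * Removal of at most three edges *)

Section FoldingGraph.
Variable R : realType.
Implicit Types (x y z u v w p q d : R * R) (s t k r e : R) (b : bool) (f g : set (R * R)).
Variable phi : R * R -> R * R.
Hypothesis fold : local_flat_folding phi.
Hypothesis fin_vertices : finite_set (vertex_point phi).
Hypothesis fin_edges : finite_set (edges (folding_graph phi)).

Local Notation G := (folding_graph phi).
Local Notation incident := (incident phi).
Local Notation stub_edge := (stub_edge phi).
Local Notation reach H := (Relation_Operators.clos_refl_trans (vtx H) (@adjacent H)).

Lemma incident_edge p f : incident p f -> edges G f.
Proof. by move=> [v [b E]]; exists (Some p), (far_end p v b); apply: stub_edge_joins. Qed.

Lemma edge_incident f : edges G f -> exists p, incident p f.
Proof.
move=> [u [v]]; case: u => [p|].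
  by move=> /joins_stub_edge[w [b [E _]]]; exists p, w, b.
case: v => [p|//]; move=> /folding_joins_sym/joins_stub_edge[w [b [E _]]].
by exists p, w, b.
Qed.

Lemma incident_vertex p f : incident p f -> vertex_point phi p.
Proof. by move=> [v [b []]]. Qed.

Lemma incident_far p v f : stub_edge p v false f -> incident (p + v) f.
Proof. by move=> /stub_edge_rev E; exists (- v), false. Qed.

Lemma incident_ends p v b f x : stub_edge p v b f -> incident x f ->
  x = p \/ (b = false /\ x = p + v).
Proof. by move=> E [v' [b' E']]; apply: stub_edge_ends E E'. Qed.

Lemma joins_incident f x (w : option (R * R)) : folding_joins phi f (Some x) w -> incident x f.
Proof. by move=> /joins_stub_edge[v [b [E _]]]; exists v, b. Qed.

Lemma reach_sym (H : multigraph) (u v : vtx H) : (forall i (j k : vtx H), joins H i j k ->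
  joins H i k j) ->
  Relation_Operators.clos_refl_trans _ (@adjacent H) u v ->
  Relation_Operators.clos_refl_trans _ (@adjacent H) v u.
Proof.
move=> sym; elim=> [i j [l Hl Hj]|i|i j k _ h1 _ h2].
- by apply: Relation_Operators.rt_step; exists l => //; apply: sym.
- exact: Relation_Operators.rt_refl.
- exact: Relation_Operators.rt_trans h2 h1.
Qed.

(** A normal to the first vector, with its sign chosen for the second. *)
Lemma obtuse_direction (W : set (R * R) -> R * R) (L : seq (set (R * R))) : (size L <= 2)%N ->
  (forall f, f \in L -> W f <> 0) ->
  exists2 u, u <> 0 & forall f, f \in L -> dot (W f) u <= 0.
Proof.
have pn v : v <> 0 -> perp v <> 0.
  by move=> /dot_gt0 v0 h; move: v0; have -> : dot v v = dot (perp v) (perp v)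
    by [rewrite /dot /=; ring]; rewrite h /dot !coordE !mul0r addr0 ltxx.
have pd v : dot v (perp v) = 0 by rewrite /dot /=; ring.
case: L => [|f [|g [|? ?]]] // _ W0.
- exists (1, 0) => // h; have /eqP := congr1 fst h; by rewrite /= oner_eq0.
- have f0 := W0 f (mem_head _ _); exists (perp (W f)); first exact: pn.
  by move=> h; rewrite inE => /eqP ->; rewrite pd.
- have f0 := W0 f (mem_head _ _).
  have [h|h] := leP (dot (W g) (perp (W f))) 0.
    exists (perp (W f)); first exact: pn.
    by move=> i; rewrite !inE => /orP[] /eqP ->; rewrite ?pd.
  exists (- perp (W f)); first by move=> /eqP; rewrite oppr_eq0 => /eqP; apply: pn.
  have dN v w : dot v (- w) = - dot v w by rewrite /dot !coordE; ring.
  by move=> i; rewrite !inE => /orP[] /eqP ->; rewrite dN ?pd ?oppr0 // oppr_le0 ltW.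
Qed.

Lemma reach_infinity_cut (F : set (set (R * R))) p : F #<= `I_3 -> vertex_point phi p ->
  reach (@remove_edges G F) (Some p) None.
Proof.
move=> F3 vp; apply: contrapT => nreach.
pose H := @remove_edges G F.
pose X := vertex_point phi `&` [set q | reach H (Some p) (Some q)].
have Xp : X p by split=> //; apply: Relation_Operators.rt_refl.
(* An edge at [X] that is not removed is not a ray, since [X] does not reach oo, and its other end
   is in [X]. *)
have leave q v b f : X q -> stub_edge q v b f -> ~ F f -> b = false /\ X (q + v).
  move=> [vq rq] E nF.
  have st : reach H (Some p) (far_end q v b).
    apply: Relation_Operators.rt_trans rq _; apply: Relation_Operators.rt_step.
    exists f; last exact: stub_edge_joins E.
    by split=> //; apply: (@incident_edge q); exists v, b.
  case: b st E => [/nreach //|st E]; split=> //; split=> //.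
  by have [] := stub_edge_rev E.
have finX : finite_set X by apply: finite_setIl.
have [xs0 xsE0] := (finite_seqP X).1 finX.
pose xs := undup xs0.
have xsE q : q \in xs <-> X q by rewrite mem_undup xsE0.
have [es0 esE0] := (finite_seqP (edges G)).1 fin_edges.
pose es := undup es0.
have esE f : f \in es <-> edges G f by rewrite mem_undup esE0.
pose I q f : bool := `[< incident q f >].
pose cnt f := count (fun q => I q f) xs.
have deg q : q \in xs -> ~~ odd (count (I q) es).
  move=> /xsE[vq _]; rewrite -size_filter; apply: (vertex_even_degree fold fin_vertices vq).
    by rewrite filter_uniq // undup_uniq.
  move=> f; rewrite mem_filter; split=> [/andP[/asboolP //]|qf].
  by apply/andP; split; [apply/asboolP | apply/esE; apply: incident_edge qf].
have cnt2 f : f \in es -> (cnt f <= 2)%N.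
  move=> /esE/edge_incident[q [v [b E]]].
  rewrite /cnt -size_filter; apply: (@uniq_leq_size _ _ [:: q; q + v]).
    by rewrite filter_uniq // undup_uniq.
  move=> x; rewrite mem_filter => /andP[/asboolP /(incident_ends E)[->|[_ ->]] _].
    by rewrite mem_head.
  by rewrite !inE eqxx orbT.
have two q q' f : X q -> X q' -> q <> q' -> incident q f -> incident q' f -> (2 <= cnt f)%N.
  move=> Xq Xq' qq' qf q'f; rewrite /cnt -size_filter.
  apply: (@uniq_leq_size _ [:: q; q']) => [|x].
    by rewrite /= inE andbT; apply/eqP.
  by rewrite !inE mem_filter => /orP[] /eqP ->; apply/andP; split;
    [apply/asboolP | apply/xsE | apply/asboolP | apply/xsE].
pose L := [seq f <- es | cnt f == 1%N].
have LF f : f \in L -> F f.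
  rewrite mem_filter => /andP[/eqP c1 fe]; apply: contrapT => nF.
  have : has (fun q => I q f) xs by rewrite has_count -/(cnt f) c1.
  move=> /hasP[q /xsE Xq /asboolP qf]; have [v [b E]] := qf.
  have [bf Xqv] := leave _ _ _ _ Xq E nF; rewrite bf in E.
  have [_ v0 _ _ _] := E.
  have qqv : q <> q + v by move=> /(congr1 (fun x => x - q)); rewrite subrr addrC addKr => /esym.
  by have := two _ _ _ Xq Xqv qqv qf (incident_far E); rewrite c1.
have uL : uniq L by rewrite filter_uniq // undup_uniq.
have L3 : (size L <= 3)%N := uniq_card_le uL LF F3.
have oddL : ~~ odd (size L) by rewrite size_filter; apply: even_boundary.
have L2 : (size L <= 2)%N by case: (size L) L3 oddL => [|[|[|[|]]]].
have [W hW] : exists W : set (R * R) -> R * R, forall f, f \in L ->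
    exists q b, X q /\ stub_edge q (W f) b f.
  have : forall f, exists v, f \in L -> exists q b, X q /\ stub_edge q v b f.
    move=> f; have [fL|nL] := boolP (f \in L); last by exists 0.
    have : has (fun q => I q f) xs.
      by rewrite has_count -/(cnt f); move: fL; rewrite mem_filter => /andP[/eqP -> _].
    by move=> /hasP[q /xsE Xq /asboolP[v [b E]]]; exists v => _; exists q, b.
  by move=> /choice[W hW]; exists W.
have W0 f : f \in L -> W f <> 0 by move=> /hW[q [b [_ []]]].
have [u u0 hu] := obtuse_direction L2 W0.
have [q Xq qmax] := finite_argmin (fun q => - dot q u) finX (ex_intro _ p Xp).
have [vq _] := Xq.
have [v [b [f [E vu]]]] := vertex_edge_direction fold fin_vertices vq u0.
have qf : incident q f by exists v, b.
have fe : f \in es by apply/esE; apply: incident_edge qf.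
(* The other end of [f] is farther in the direction [u] than the extremal [q], hence not in [X]. *)
have only q' : X q' -> incident q' f -> q' = q.
  move=> Xq' /(incident_ends E)[//|[bf q'E]]; exfalso.
  have := qmax q' Xq'; rewrite q'E; have -> : dot (q + v) u = dot q u + dot v u
    by rewrite /dot !coordE; ring.
  by rewrite lerNr opprK; lra.
have fL : f \in L.
  rewrite mem_filter fe andbT eqn_leq; apply/andP; split; last first.
    by rewrite -/(cnt f) /cnt -has_count; apply/hasP; exists q; [apply/xsE | apply/asboolP].
  rewrite /cnt -size_filter; apply: (@uniq_leq_size _ _ [:: q]).
    by rewrite filter_uniq // undup_uniq.
  by move=> x; rewrite mem_filter => /andP[/asboolP xf /xsE /only->//]; rewrite mem_head.
have [q' [b' [Xq' E']]] := hW f fL.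
have qq : q' = q by apply: only => //; exists (W f), b'.
rewrite qq in E'; have [c c0 vE] := stub_edge_direction E' E.
have := hu f fL; move: vu; rewrite vE.
have -> : dot (c *: W f) u = c * dot (W f) u by rewrite /dot !coordE; ring.
by rewrite pmulr_rgt0 // ltNge => /negP.
Qed.

End FoldingGraph.

(** * Removal of one vertex *)

Section Removal.
Variable R : realType.
Implicit Types (x y z u v w p q d : R * R) (s t k r e : R) (b : bool) (f g : set (R * R)).
Variable phi : R * R -> R * R.
Hypothesis fold : local_flat_folding phi.
Hypothesis fin_vertices : finite_set (vertex_point phi).
Hypothesis fin_edges : finite_set (edges (folding_graph phi)).

Local Notation G := (folding_graph phi).
Local Notation incident := (incident phi).
Local Notation stub_edge := (stub_edge phi).
Local Notation reach H := (Relation_Operators.clos_refl_trans (vtx H) (@adjacent H)).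

Lemma reach_infinity_remove p0 p : vertex_point phi p -> p <> p0 ->
  reach (@remove_vertex G (Some p0)) (Some p) None.
Proof.
move=> vp pp0; apply: contrapT => nreach.
pose H := @remove_vertex G (Some p0); pose u := p - p0.
have u0 : u <> 0 by move=> /eqP; rewrite subr_eq0 => /eqP.
have pu : dot p0 u < dot p u.
  by have := dot_gt0 u0; have -> : dot u u = dot p u - dot p0 u by [rewrite /u /dot !coordE;
    ring]; rewrite subr_gt0.
pose X := vertex_point phi `&` [set q | reach H (Some p) (Some q)].
have Xp : X p by split=> //; apply: Relation_Operators.rt_refl.
have finX : finite_set X by apply: finite_setIl.
have [q Xq qmax] := finite_argmin (fun q => - dot q u) finX (ex_intro _ p Xp).
have [vq rq] := Xq.
have [v [b [f [E vu]]]] := vertex_edge_direction fold fin_vertices vq u0.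
have qu : dot p0 u < dot q u.
  by apply: lt_le_trans pu _; have := qmax p Xp; rewrite lerN2.
have qvu : dot (q + v) u = dot q u + dot v u by rewrite /dot !coordE; ring.
(* Each end of [f] is at least as high as [p] in the direction [u], hence strictly higher than
   [p0]. *)
have nf (w : option (R * R)) : ~ folding_joins phi f (Some p0) w.
  move=> /joins_incident/(incident_ends E)[p0q|[_ p0q]]; move: qu; rewrite p0q ?ltxx //.
  by rewrite qvu; lra.
have st : reach H (Some p) (far_end q v b).
  apply: Relation_Operators.rt_trans rq _; apply: Relation_Operators.rt_step.
  exists f; last exact: stub_edge_joins E.
  split; last exact: nf.
  by apply: (@incident_edge _ _ q); exists v, b.
case: b E st => [_ /nreach //|E st].
have Xqv : X (q + v) by split=> //; have [] := stub_edge_rev E.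
by have := qmax _ Xqv; rewrite lerN2 qvu; lra.
Qed.

(** End points are added through [incident], so the set does not depend on the end from which the
    edge is parametrized. Being closed, it has a point nearest to any given point. *)
Definition edge_closure f : set (R * R) := f `|` [set p | incident p f].

Lemma edge_closureE q v b f : stub_edge q v b f ->
  forall x, edge_closure f x <-> exists2 k : R, in_range b k & x = q + k *: v.
Proof.
move=> E x; have [_ v0 fE _ _] := E; split.
- move=> [|/= /(incident_ends E)[->|[-> ->]]].
  + rewrite fE => -[k [k0 kb] ->]; exists k => //; split; first exact: ltW.
    by case: kb => [|/ltW]; [left | right].
  + by exists 0; [split=> //; right; exact: ler01 | rewrite scale0r addr0].
  + by exists 1; [split; [exact: ler01 | right] | rewrite scale1r].
- move=> [k [k0 kb] ->].
  have [->|kN0] := eqVneq k 0; first by right; exists v, b; rewrite scale0r addr0.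
  have kp : 0 < k by rewrite lt_neqAle eq_sym kN0.
  case: b E fE kb => E fE kb; first by left; rewrite fE; exists k => //; split=> //; left.
  case: kb => [//|]; rewrite le_eqVlt => /orP[/eqP ->|k1].
    by right; rewrite scale1r /=; apply: (incident_far E).
  by left; rewrite fE; exists k => //; split=> //; right.
Qed.

Lemma edge_closure_nearest x f : edges G f -> exists2 y, edge_closure f y &
  forall z, edge_closure f z -> enorm (x - y) <= enorm (x - z).
Proof.
move=> /edge_incident[q [v [b E]]]; have [_ v0 _ _ _] := E.
have [k kb hk] := nearest_point x q b v0.
exists (q + k *: v); first by apply/(edge_closureE E); exists k.
by move=> z /(edge_closureE E)[j jb ->]; apply: hk.
Qed.

Lemma at_end_incident q v b f k : stub_edge q v b f -> at_end b k -> incident (q + k *: v) f.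
Proof.
move=> E [->|[bf ->]]; first by rewrite scale0r addr0; exists v, b.
by rewrite scale1r; rewrite bf in E; apply: incident_far E.
Qed.

Lemma edge_closure_disjoint f g z : f <> g -> (forall p, incident p f -> ~ incident p g) ->
  edges G f -> edges G g -> edge_closure f z -> ~ edge_closure g z.
Proof.
move=> fg dis /edge_incident[p [v [b E]]] /edge_incident[q [w [c E']]].
have [_ _ _ crf _] := E; have [_ _ _ crg _] := E'.
move=> [fz|/= zf] [gz|/= zg].
- by apply: fg; apply: (stub_edge_inter fold E E' fz gz).
- by apply: (crease_not_vertex (crf _ fz)); apply: incident_vertex zg.
- by apply: (crease_not_vertex (crg _ gz)); apply: incident_vertex zf.
- exact: dis zf zg.
Qed.

(* If p and q were separated, take a vertex a and an edge f, one in the component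
   of p and the other not, at minimal distance, attained at y.  Some edge g at a
   approaches y, and sliding along g and f leads to an even closer pair. *)
Lemma reach_remove_infinity p q : vertex_point phi p -> vertex_point phi q ->
  reach (@remove_vertex G None) (Some p) (Some q).
Proof.
move=> vp vq; apply: contrapT => nreach.
pose H := @remove_vertex G None.
pose X x := reach H (Some p) (Some x).
have Xp : X p by apply: Relation_Operators.rt_refl.
have step f x x' : incident x f -> incident x' f -> X x -> X x'.
  move=> [v [b E]] x'f Xx; have [->//|[bf x'E]] := incident_ends E x'f.
  rewrite bf in E; apply: Relation_Operators.rt_trans Xx _; apply: Relation_Operators.rt_step.
  exists f; last by rewrite x'E; apply: (stub_edge_joins E).
  split; first by apply: (@incident_edge _ _ x); exists v, false.
  (* A segment is not also a ray: as a ray from [a] it would have [a] as its only end, and [x], [x']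
     would coincide. *)
  move=> [a|//] /folding_joins_sym/joins_stub_edge[d [b' [E' /=]]].
  case: b' E' => // E' _; have xf : incident x f by exists v, false.
  have [_ v0 _ _ _] := E.
  case: (incident_ends E' x'f) => [|[//]] x'a; case: (incident_ends E' xf) => [|[//]] xa.
  by apply: v0; have := x'E; rewrite x'a xa => /(congr1 (fun y => y - a));
    rewrite subrr addrC addKr.
(* The side of an edge is that of any of its ends. The condition is symmetric in the two sides,
   because the final slide may stop at a vertex point of either. *)
pose A : set ((R * R) * set (R * R)) := [set af | vertex_point phi af.1 /\ edges G af.2 /\
  exists x, incident x af.2 /\ ~ (X af.1 <-> X x)].
have finA : finite_set A.
  apply: (@sub_finite_set _ _ (vertex_point phi `*` edges G)); last exact: finite_setX.
  by move=> af [va [fe _]].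
have [y hy] : exists y : (R * R) * set (R * R) -> R * R, forall af, A af ->
    edge_closure af.2 (y af) /\ forall z,
      edge_closure af.2 z -> enorm (af.1 - y af) <= enorm (af.1 - z).
  have : forall af, exists y, A af ->
    edge_closure af.2 y /\ forall z, edge_closure af.2 z -> enorm (af.1 - y) <= enorm (af.1 - z).
    move=> af; have [[va [fe ex]]|nA] := pselect (A af); last by exists 0 => /nA.
    by have [y yf hy] := edge_closure_nearest af.1 fe; exists y.
  by move=> /choice[y hy]; exists y.
have A0 : A !=set0.
  have e1 : ((1, 0) : R * R) <> 0 by move=> /(congr1 fst) /= /eqP; rewrite oner_eq0.
  have [v [b [f [E _]]]] := vertex_edge_direction fold fin_vertices vq e1.
  have qf : incident q f by exists v, b.
  exists (p, f); split=> //; split; first exact: (incident_edge qf).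
  by exists q; split=> // -[h _]; apply: nreach; apply: h.
have [[a f] Aaf min] := finite_argmin (fun af => enorm (af.1 - y af)) finA A0.
have [yf ymin] := hy _ Aaf; have [/= va [/= fe [x [/= xf Xax]]]] := Aaf.
have side x' : incident x' f -> ~ (X a <-> X x').
  by move=> x'f h; apply: Xax; rewrite h; split; apply: (step f).
have anf : ~ edge_closure f a.
  move=> [fa|/= /side h]; last exact: h.
  have [z [v [b [_ _ _ cr _]]]] := edge_incident fe.
  exact: (crease_not_vertex (cr _ fa)).
set yy := y (a, f) in yf ymin min.
have u0 : yy - a <> 0 by move=> /eqP; rewrite subr_eq0 => /eqP h; apply: anf; rewrite -h.
have [v [b [g [E vu]]]] := vertex_edge_direction fold fin_vertices va u0.
have [_ v0 gE _ _] := E; have vv := dot_gt0 v0.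
have ag : incident a g by exists v, b.
have ge := incident_edge ag.
have [w0 [v' [b' E']]] := edge_incident fe; have [_ v'0 _ _ _] := E'.
have sideg x' : incident x' g -> (X a <-> X x') by move=> x'g; split; apply: (step g).
have disj z : edge_closure g z -> ~ edge_closure f z.
  apply: edge_closure_disjoint => //.
    by move=> gf; apply: anf; rewrite -gf; right.
  by move=> z' /sideg h /side; apply.
(* The step to the foot of the perpendicular from [yy], cut at 1 to stay on [g]. *)
pose s := Num.min 1 (dot v (yy - a) / dot v v).
have s0 : 0 < s by rewrite lt_min ltr01 divr_gt0.
have s1 : s <= 1 by rewrite ge_min lexx.
have s2 : s * dot v v <= dot v (yy - a) by rewrite -ler_pdivlMr // ge_min lexx orbT.
have closer : enorm (a + s *: v - yy) < enorm (a - yy).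
  rewrite ltNge enorm_le -ltNge.
  have -> : dot (a + s *: v - yy) (a + s *: v - yy) =
     dot (a - yy) (a - yy) - s * (2 * dot v (yy - a) - s * dot v v) by rewrite /dot !coordE; ring.
  by rewrite ltrBlDr ltrDl mulr_gt0 //; lra.
have [t tb yE] := (edge_closureE E' yy).1 yf.
have dis' i j : in_range b i -> in_range b' j -> a + i *: v <> w0 + j *: v'.
  move=> ib jb h; apply: (disj (a + i *: v)).
    by apply/(edge_closureE E); exists i.
  by apply/(edge_closureE E'); exists j.
have sb : in_range b s by split; [exact: ltW | right].
have [i [j [ib jb ij ends]]] := slide_to_end v0 v'0 dis' sb tb.
rewrite -yE in ij.
have ij' : enorm (a + i *: v - (w0 + j *: v')) < enorm (a - yy) by apply: le_lt_trans closer.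
have gi : edge_closure g (a + i *: v) by apply/(edge_closureE E); exists i.
have fj : edge_closure f (w0 + j *: v') by apply/(edge_closureE E'); exists j.
(* An end of [g] is on the side of [a] and is paired with [f]; an end of [f] is on the other side
   and is paired with [g]. Either pair beats the minimum. *)
case: ends => [/(at_end_incident E) h|/(at_end_incident E') h].
  have A1 : A (a + i *: v, f).
    split; first exact: incident_vertex h.
    split=> //; exists x; split=> // h'; apply: (side x xf); rewrite -h'; exact: sideg.
  have := (hy _ A1).2 _ fj; have := min _ A1 => /= h1 h2.
  by move: ij'; rewrite ltNge (le_trans h1 h2).
have A1 : A (w0 + j *: v', g).
  split; first exact: incident_vertex h.
  split=> //; exists a; split=> // h'; apply: (side _ h); by rewrite /= in h'; rewrite h'.
have := (hy _ A1).2 _ gi; have := min _ A1 => /= h1 h2.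
by move: ij'; rewrite enormB ltNge (le_trans h1 h2).
Qed.

End Removal.

Theorem theorem4 (R : realType) (phi : R * R -> R * R)
  (hphi : local_flat_folding phi)
  (hfin : finite_graph (folding_graph phi)) :
  two_vertex_connected (folding_graph phi) /\
  four_edge_connected (folding_graph phi).
Proof.
have [fv fin_edges] := hfin.
have fin_vertices : finite_set (vertex_point phi).
  apply: (@sub_finite_set _ _ (odflt 0 @` folding_vertices phi)); last exact: finite_image.
  by move=> p vp; exists (Some p).
have hub (H : multigraph) (c : vtx H) : (forall e u v, joins H e u v -> joins H e v u) ->
    (forall u, vertices H u -> Relation_Operators.clos_refl_trans _ (@adjacent H) u c) ->
    connected_graph H.
  move=> sym hc u v /hc uc /hc vc; apply: Relation_Operators.rt_trans uc _.
  exact: reach_sym.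
have sym := @folding_joins_sym R phi.
have cut F : F #<= `I_3 -> connected_graph (@remove_edges (folding_graph phi) F).
  move=> F3; apply: (hub (@remove_edges (folding_graph phi) F) None) => //.
  move=> [p vp|_]; last exact: Relation_Operators.rt_refl.
  exact: reach_infinity_cut.
split; last by move=> F _; apply: cut.
split.
  (* Plain connectivity is the cut that removes no edge. *)
  have c0 : connected_graph (@remove_edges (folding_graph phi) set0) by apply: cut; apply: card_ge0.
  move=> u v uG vG; elim: (c0 u v uG vG) => [i j [e [eG _] ij]|i|i j k _ h1 _ h2].
  - by apply: Relation_Operators.rt_step; exists e.
  - exact: Relation_Operators.rt_refl.
  - exact: Relation_Operators.rt_trans h1 h2.
move=> [p0|] [_]; apply.
  apply: (hub (@remove_vertex (folding_graph phi) (Some p0)) None) => //.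
  move=> [p [vp pp0]|_]; last exact: Relation_Operators.rt_refl.
  by apply: reach_infinity_remove => // h; apply: pp0; rewrite h.
by move=> [p|] [q|] [vp np] [vq nq] //; apply: reach_remove_infinity.
Qed.
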